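(* Let $X$ be a simplicial set, and suppose we are given: (1) a category $A^x$ for each $x\in X_1$, such that (1.a) $A^{s_0y}=I$ for every $y\in X_0$; (2) a functor $T^x:\prod_{i\in[n]^-}A^{x_{i,i+1}}\to A^{x_{0,n}}$ for each $n\ge1$ and $x\in X_n$, such that (2.a) $T^x=1_{A^x}$ when $n=1$, and (2.b) $T^{sx}=T^x$ for every degeneracy map $s$; (3) a natural transformation $\eta^x_{\mathsf C}:T^{x_{\mathsf C}}\circ\prod_{c\in\mathsf C^-}T^{x_{[c,c^+]}}\Rightarrow T^x$ for each $n\ge1$, $x\in X_n$ and $\{0,n\}\subseteq\mathsf C\subseteq[n]$, such that (3.a) $\eta^x_{\mathsf C}=1_{T^x}$ whenever $\mathsf C=\{0,n\}$ or $\mathsf C=[n]$, and (3.b) $\eta^{sx}_{\mathsf C}=\eta^x_{\sigma\mathsf C}$ for every degeneracy map $s$, with corresponding codegeneracy $\sigma:[n+1]\to[n]$, and every $\{0,n+1\}\subseteq\mathsf C\subseteq[n+1]$. Then there exists a unique simplicial map $\phi:X\to N_\Delta(N_2\mathsf{Cat})$ with $\phi_1(x)(\{0,1\})=A^x$ for each $x\in X_1$; $\phi_n(x)(\{0,n\}\subseteq[n])=T^x$ for each $n\ge1$, $x\in X_n$; and $\phi_n(x)(\{0,n\}\subseteq\mathsf C\subseteq[n])=\eta^x_{\mathsf C}$ for each $n\ge1$, $x\in X_n$, $\{0,n\}\subseteq\mathsf C\subseteq[n]$, if and only if for every $n\ge4$, every non-degenerate $x\in X_n$ and every chain of proper inclusions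 $\{0,n\}\subset\mathsf A\subset\mathsf B\subset[n]$, $$\eta^x_{\mathsf B}\bullet\bigl(\eta^{x_{\mathsf B}}_{\delta_{\mathsf B}^{-1}\mathsf A}\circ1\bigr)=\eta^x_{\mathsf A}\bullet\Bigl(1\circ\prod_{a\in\mathsf A^-}\eta^{x_{[a,a^+]}}_{\delta_{[a,a^+]}^{-1}(\mathsf B\cap[a,a^+])}\Bigr).$$
   Context: Conventions. All categories are small, $I$ is the terminal category. The product of categories (and functors) is treated as strictly associative and unital: $(A\times B)\times C=A\times(B\times C)$, $A\times I=A=I\times A$ (one replaces the monoidal 2-category $\mathsf{Cat}$ by an equivalent strict one). $\circ$ denotes composition of functors and horizontal composition of natural transformations, $\bullet$ vertical composition. Faces. For $\mathsf C=\{c_0<\dots<c_m\}\subseteq[n]=\{0,\dots,n\}$, $\delta_{\mathsf C}:[m]\to[n]$ is $i\mapsto c_i$, and for $x\in X_n$, $x_{\mathsf C}=X(\delta_{\mathsf C})(x)\in X_m$; write $x_{p,q}=x_{\{p,q\}}$. $\mathsf C^-=\mathsf C\setminus\{\max\mathsf C\}$, and for $c\in\mathsf C^-$, $c^+$ is the next element of $\mathsf C$ (for $a\in\mathsf A^-$, $a^+$ is the successor in $\mathsf A$). $[a,b]$ denotes $\{a,a+1,\dots,b\}$. A degeneracy map $s$ is $X(\sigma)$ for a codegeneracy $\sigma=\sigma_k:[n+1]\to[n]$. Homotopy coherent nerve. $S[n]$ is the simplicially enriched category with objects $0,\dots,n$; for $p\le q$, $S[n](p,q)$ is the nerve of the poset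 of subsets of $\{p,\dots,q\}$ containing $p$ and $q$ (and $S[n](p,q)=\emptyset$ for $q<p$). A $k$-simplex is written as a chain $C_0\subseteq\dots\subseteq C_k$; orientation: an inclusion $C_0\subseteq C_1$ is an arrow from $C_1$ to $C_0$, so $d_i$ deletes $C_{k-i}$. Composition is union, identities are $\{p\}$. For a simplicially enriched category $U$, $N_\Delta(U)_n$ is the set of simplicially enriched functors $S[n]\to U$; an order-preserving map $[m]\to[n]$ induces $S[m]\to S[n]$ by direct image of subsets, and acts on $N_\Delta(U)$ by precomposition. For $L\in N_\Delta(U)_n$, $L(\text{chain})$ denotes its value on that simplex of a mapping space. $N_2(\mathsf{Cat})$ is the simplicially enriched category with one object $*$ whose mapping simplicial set has: $0$-simplices categories; $1$-simplices functors $T$ ($d_1T$ the domain, $d_0T$ the codomain); $2$-simplices natural transformations $\eta:T_{12}\circ T_{01}\Rightarrow T_{02}$ ($d_0\eta=T_{12}$, $d_1\eta=T_{02}$, $d_2\eta=T_{01}$); $3$-simplices families $\eta_{ijk}:T_{jk}\circ T_{ij}\Rightarrow T_{ik}$ ($0\le i<j<k\le3$) with $\eta_{013}\bullet(\eta_{123}\circ1)=\eta_{023}\bullet(1\circ\eta_{012})$; higher simplices by $3$-coskeletality; degeneracies insert identities. Composition is given by $\times$, with identity $I$. $N_\Delta(N_2\mathsf{Cat})$ is its homotopy coherent nerve. *)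

(* Defs.v *)
From mathcomp Require Import all_boot boolp.

Set Implicit Arguments.
Unset Strict Implicit.
Unset Printing Implicit Defensive.

Record category := Category {
  obj :> Type;
  hom : obj -> obj -> Type;
  idm : forall a, hom a a;
  cmp : forall a b c, hom b c -> hom a b -> hom a c;
  cmp1m : forall a b (f : hom a b), cmp (idm b) f = f;
  cmpm1 : forall a b (f : hom a b), cmp f (idm a) = f;
  cmpA : forall a b c d (h : hom c d) (g : hom b c) (f : hom a b),
    cmp h (cmp g f) = cmp (cmp h g) f
}.
Arguments hom {_}.
Arguments idm {_}.
Arguments cmp {_ a b c}.

Record functor (C D : category) := Functor {
  fobj :> C -> D;
  fmap : forall a b, hom a b -> hom (fobj a) (fobj b);
  fmap1 : forall a, fmap (idm a) = idm (fobj a);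
  fmapM : forall a b c (g : hom b c) (f : hom a b),
    fmap (cmp g f) = cmp (fmap g) (fmap f)
}.
Arguments fmap {C D} _ {a b}.

Record nattrans (C D : category) (F G : functor C D) := Nattrans {
  ncomp :> forall a : C, hom (F a) (G a);
  ncompN : forall a b (f : hom a b),
    cmp (ncomp b) (fmap F f) = cmp (fmap G f) (ncomp a)
}.

Definition fid (C : category) : functor C C.
Proof. by exists (fun a => a) (fun a b f => f). Defined.

Definition fcomp (C D E : category) (G : functor D E) (F : functor C D) :
  functor C E.
Proof.
exists (fun a => G (F a)) (fun a b f => fmap G (fmap F f)).
- by move=> a; rewrite !fmap1.
- by move=> a b c g f; rewrite !fmapM.
Defined.

Definition nid (C D : category) (F : functor C D) : nattrans F F.
Proof.
by exists (fun a => idm (F a)) => a b f; rewrite cmp1m cmpm1.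
Defined.

Definition nvcomp (C D : category) (F G H : functor C D)
  (beta : nattrans G H) (alpha : nattrans F G) : nattrans F H.
Proof.
exists (fun a => cmp (beta a) (alpha a)) => a b f.
by rewrite -cmpA ncompN cmpA ncompN cmpA.
Defined.

Definition nhcomp (C D E : category) (F F' : functor C D) (G G' : functor D E)
  (beta : nattrans G G') (alpha : nattrans F F') :
  nattrans (fcomp G F) (fcomp G' F').
Proof.
exists (fun a => cmp (fmap G' (alpha a)) (beta (F a))) => a b f /=.
by rewrite -cmpA ncompN cmpA -fmapM ncompN fmapM cmpA.
Defined.

(** The strict monoidal 2-category replacing (Cat, x, I): objects are words
(finite lists) of small categories, a word standing for the product of its
letters; 1-cells and 2-cells are the functors and natural transformations
between these products.  The product of objects is concatenation, with unit the
empty word, and [w |-> wprod w] is a biequivalence with Cat.  So "a category" is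
a [word] in the sequel. *)

Definition word := seq category.

Definition cat1 : category.
Proof.
by exists unit (fun _ _ => unit) (fun _ => tt) (fun _ _ _ _ _ => tt) => // a b [].
Defined.

Definition catX (C D : category) : category.
Proof.
exists (C * D)%type (fun a b => hom a.1 b.1 * hom a.2 b.2)%type
  (fun a => (idm a.1, idm a.2))
  (fun a b c g f => (cmp g.1 f.1, cmp g.2 f.2)).
- by move=> a b [f g]; rewrite !cmp1m.
- by move=> a b [f g]; rewrite !cmpm1.
- by move=> a b c d f g h; rewrite !cmpA.
Defined.

Fixpoint wprod (w : word) : category :=
  if w is C :: w' then catX C (wprod w') else cat1.

(** The isomorphism between [wprod (v ++ w)] and the product of [wprod v] and
[wprod w]: the two projections and the pairing. *)

Fixpoint wfst_obj v w : wprod (v ++ w) -> wprod v :=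
  match v with
  | [::] => fun _ => tt
  | C :: v' => fun p => (p.1, wfst_obj p.2)
  end.

Fixpoint wsnd_obj v w : wprod (v ++ w) -> wprod w :=
  match v with
  | [::] => fun p => p
  | C :: v' => fun p => wsnd_obj p.2
  end.

Fixpoint wpair_obj v w : wprod v -> wprod w -> wprod (v ++ w) :=
  match v with
  | [::] => fun _ q => q
  | C :: v' => fun p q => (p.1, wpair_obj p.2 q)
  end.

Fixpoint wfst_map v w : forall p q : wprod (v ++ w),
    hom p q -> hom (wfst_obj p) (wfst_obj q) :=
  match v with
  | [::] => fun _ _ _ => tt
  | C :: v' => fun p q f => (f.1, wfst_map f.2)
  end.

Fixpoint wsnd_map v w : forall p q : wprod (v ++ w),
    hom p q -> hom (wsnd_obj p) (wsnd_obj q) :=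
  match v with
  | [::] => fun _ _ f => f
  | C :: v' => fun p q f => wsnd_map f.2
  end.

Fixpoint wpair_map v w : forall (p p' : wprod v) (q q' : wprod w),
    hom p p' -> hom q q' -> hom (wpair_obj p q) (wpair_obj p' q') :=
  match v with
  | [::] => fun _ _ _ _ _ g => g
  | C :: v' => fun p p' q q' f g => (f.1, wpair_map f.2 g)
  end.

Definition wfst v w : functor (wprod (v ++ w)) (wprod v).
Proof.
exists (@wfst_obj v w) (@wfst_map v w).
- by elim: v => [|C v IH] //= [a p] /=; rewrite IH.
- by elim: v => [|C v IH] //= p q r f g; rewrite IH.
Defined.

Definition wsnd v w : functor (wprod (v ++ w)) (wprod w).
Proof.
exists (@wsnd_obj v w) (@wsnd_map v w).
- by elim: v => [|C v IH] //= [a p] /=; rewrite IH.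
- by elim: v => [|C v IH] //= p q r f g; rewrite IH.
Defined.

Lemma wpair_map1 v w (p : wprod v) (q : wprod w) :
  wpair_map (idm p) (idm q) = idm (wpair_obj p q).
Proof. by elim: v p => [|C v IH] //= p; rewrite IH. Qed.

Lemma wpair_mapM v w (p p' p'' : wprod v) (q q' q'' : wprod w)
    (f' : hom p' p'') (f : hom p p') (g' : hom q' q'') (g : hom q q') :
  wpair_map (cmp f' f) (cmp g' g) = cmp (wpair_map f' g') (wpair_map f g).
Proof.
elim: v p p' p'' f' f => [|C v IH] //= p p' p'' f' f.
by rewrite IH.
Qed.

Definition ftens v v' w w' (F : functor (wprod v) (wprod v'))
    (G : functor (wprod w) (wprod w')) :
  functor (wprod (v ++ w)) (wprod (v' ++ w')).
Proof.
exists (fun p => wpair_obj (F (wfst v w p)) (G (wsnd v w p)))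
  (fun p q f => wpair_map (fmap F (fmap (wfst v w) f))
                          (fmap G (fmap (wsnd v w) f))).
- by move=> p; rewrite !fmap1 wpair_map1.
- by move=> p q r g f; rewrite !fmapM wpair_mapM.
Defined.

Definition ntens v v' w w' (F F' : functor (wprod v) (wprod v'))
    (G G' : functor (wprod w) (wprod w'))
    (alpha : nattrans F F') (beta : nattrans G G') :
  nattrans (ftens F G) (ftens F' G').
Proof.
exists (fun p => wpair_map (alpha (wfst v w p)) (beta (wsnd v w p))) => p q f /=.
by rewrite -!wpair_mapM !ncompN.
Defined.

(** Cells are bundled with their boundaries, so that equality of cells is
Leibniz equality and includes equality of domains and codomains. *)

Record cell1 := Cell1 {
  dom1 : word;
  cod1 : word;
  fun1 : functor (wprod dom1) (wprod cod1)
}.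
Arguments Cell1 {dom1 cod1}.

Record cell2 := Cell2 {
  dom2 : word;
  cod2 : word;
  srcf2 : functor (wprod dom2) (wprod cod2);
  tgtf2 : functor (wprod dom2) (wprod cod2);
  nat2 : nattrans srcf2 tgtf2
}.
Arguments Cell2 {dom2 cod2 srcf2 tgtf2}.

Definition src2 (a : cell2) : cell1 := Cell1 (srcf2 a).
Definition tgt2 (a : cell2) : cell1 := Cell1 (tgtf2 a).

Definition id1 (w : word) : cell1 := Cell1 (fid (wprod w)).
Definition id2 (F : cell1) : cell2 := Cell2 (nid (fun1 F)).

Definition tens1 (F G : cell1) : cell1 := Cell1 (ftens (fun1 F) (fun1 G)).
Definition tens2 (a b : cell2) : cell2 := Cell2 (ntens (nat2 a) (nat2 b)).

(** The three compositions are partial.  They are specified on composable cells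
by the relations below; the functions [comp1], [vcomp] and [hcomp] return an
arbitrary default value when the cells are not composable. *)

Inductive is_comp1 : cell1 -> cell1 -> cell1 -> Prop :=
  IsComp1 u v w (G : functor (wprod v) (wprod w))
    (F : functor (wprod u) (wprod v)) :
    is_comp1 (Cell1 G) (Cell1 F) (Cell1 (fcomp G F)).

Inductive is_vcomp : cell2 -> cell2 -> cell2 -> Prop :=
  IsVcomp u v (F G H : functor (wprod u) (wprod v))
    (b : nattrans G H) (a : nattrans F G) :
    is_vcomp (Cell2 b) (Cell2 a) (Cell2 (nvcomp b a)).

Inductive is_hcomp : cell2 -> cell2 -> cell2 -> Prop :=
  IsHcomp u v w (F F' : functor (wprod u) (wprod v))
    (G G' : functor (wprod v) (wprod w))
    (b : nattrans G G') (a : nattrans F F') :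
    is_hcomp (Cell2 b) (Cell2 a) (Cell2 (nhcomp b a)).

Definition the (T : Type) (x0 : T) (P : T -> Prop) : T :=
  if pselect (exists x, P x) is left h then projT1 (cid h) else x0.

Definition comp1 (G F : cell1) : cell1 := the G (is_comp1 G F).
Definition vcomp (b a : cell2) : cell2 := the b (is_vcomp b a).
Definition hcomp (b a : cell2) : cell2 := the b (is_hcomp b a).

Lemma the_eq T (x0 : T) (P : T -> Prop) x :
  P x -> (forall y, P y -> y = x) -> the x0 P = x.
Proof.
move=> Px Pu; rewrite /the; case: pselect => [h|[]]; last by exists x.
by case: cid => y /= /Pu.
Qed.

Lemma existT_inj2 (T : Type) (P : T -> Type) x (p q : P x) :
  existT P x p = existT P x q -> p = q.
Proof.
move=> h; have := projT2_eq h.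
by rewrite (Prop_irrelevance (projT1_eq h) erefl).
Qed.

Lemma Cell1_inj u v (F G : functor (wprod u) (wprod v)) :
  Cell1 F = Cell1 G -> F = G.
Proof.
pose P (x : word * word) := functor (wprod x.1) (wprod x.2).
move/(congr1 (fun c => existT P (dom1 c, cod1 c) (fun1 c))).
exact: (@existT_inj2 _ P).
Qed.

Lemma Cell2_inj u v (F G : functor (wprod u) (wprod v)) (a b : nattrans F G) :
  Cell2 a = Cell2 b -> a = b.
Proof.
pose Q (x : word * word) := functor (wprod x.1) (wprod x.2).
pose P (x : {x : word * word & (Q x * Q x)%type}) :=
  nattrans (projT2 x).1 (projT2 x).2.
move/(congr1 (fun c => existT P (existT (fun x => (Q x * Q x)%type)
  (dom2 c, cod2 c) (srcf2 c, tgtf2 c)) (nat2 c))).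
exact: (@existT_inj2 _ P).
Qed.

Lemma comp1E u v w (G : functor (wprod v) (wprod w))
    (F : functor (wprod u) (wprod v)) :
  comp1 (Cell1 G) (Cell1 F) = Cell1 (fcomp G F).
Proof.
apply: the_eq => [|y h]; first exact: IsComp1.
suff H g f z : is_comp1 g f z -> forall u v w (G : functor (wprod v) (wprod w))
    (F : functor (wprod u) (wprod v)),
    g = Cell1 G -> f = Cell1 F -> z = Cell1 (fcomp G F).
  exact: (H _ _ _ h).
case=> u0 v0 w0 G0 F0 u' v' w' G' F' eG eF.
have eu := congr1 dom1 eF; have ev := congr1 dom1 eG; have ew := congr1 cod1 eG.
move: eu ev ew => /= eu ev ew; subst u' v' w'.
by rewrite (Cell1_inj eG) (Cell1_inj eF).
Qed.

Lemma vcompE u v (F G H : functor (wprod u) (wprod v))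
    (b : nattrans G H) (a : nattrans F G) :
  vcomp (Cell2 b) (Cell2 a) = Cell2 (nvcomp b a).
Proof.
apply: the_eq => [|y h]; first exact: IsVcomp.
suff K g f z : is_vcomp g f z ->
    forall u v (F G H : functor (wprod u) (wprod v))
      (b : nattrans G H) (a : nattrans F G),
    g = Cell2 b -> f = Cell2 a -> z = Cell2 (nvcomp b a).
  exact: (K _ _ _ h).
case=> u0 v0 F0 G0 H0 b0 a0 u' v' F' G' H' b' a' eb ea.
have eu := congr1 dom2 eb; have ev := congr1 cod2 eb.
move: eu ev => /= eu ev; subst u' v'.
have eF := Cell1_inj (congr1 src2 ea); have eG := Cell1_inj (congr1 src2 eb).
have eH := Cell1_inj (congr1 tgt2 eb).
move: eF eG eH => /= eF eG eH; subst F' G' H'.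
by rewrite (Cell2_inj ea) (Cell2_inj eb).
Qed.

Lemma hcompE u v w (F F' : functor (wprod u) (wprod v))
    (G G' : functor (wprod v) (wprod w))
    (b : nattrans G G') (a : nattrans F F') :
  hcomp (Cell2 b) (Cell2 a) = Cell2 (nhcomp b a).
Proof.
apply: the_eq => [|y h]; first exact: IsHcomp.
suff K g f z : is_hcomp g f z ->
    forall u v w (F F' : functor (wprod u) (wprod v))
    (G G' : functor (wprod v) (wprod w))
    (b : nattrans G G') (a : nattrans F F'),
    g = Cell2 b -> f = Cell2 a -> z = Cell2 (nhcomp b a).
  exact: (K _ _ _ h).
case=> u0 v0 w0 F0 F0' G0 G0' b0 a0 u' v' w' F1 F1' G1 G1' b' a' eb ea.
have eu := congr1 dom2 ea; have ev := congr1 dom2 eb.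
have ew := congr1 cod2 eb.
move: eu ev ew => /= eu ev ew; subst u' v' w'.
have eF := Cell1_inj (congr1 src2 ea); have eG := Cell1_inj (congr1 src2 eb).
have eF' := Cell1_inj (congr1 tgt2 ea); have eG' := Cell1_inj (congr1 tgt2 eb).
move: eF eG eF' eG' => /= eF eG eF' eG'; subst F1 G1 F1' G1'.
by rewrite (Cell2_inj ea) (Cell2_inj eb).
Qed.

Lemma comp1_ind (P : cell1 -> cell1 -> Prop) :
  (forall u v w (G : functor (wprod v) (wprod w))
     (F : functor (wprod u) (wprod v)), P (Cell1 G) (Cell1 F)) ->
  forall G F, cod1 F = dom1 G -> P G F.
Proof. by move=> PGF [v w G] [u v' F] /= e; subst v'. Qed.

Lemma vcomp_ind (P : cell2 -> cell2 -> Prop) :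
  (forall u v (F G H : functor (wprod u) (wprod v))
    (b : nattrans G H) (a : nattrans F G), P (Cell2 b) (Cell2 a)) ->
  forall b a, tgt2 a = src2 b -> P b a.
Proof.
move=> Pba [u v G H b] [u' v' F G' a] e.
have eu := congr1 dom1 e; have ev := congr1 cod1 e.
move: eu ev => /= eu ev; subst u' v'.
by have /= eG := Cell1_inj e; subst G'.
Qed.

Lemma hcomp_ind (P : cell2 -> cell2 -> Prop) :
  (forall u v w (F F' : functor (wprod u) (wprod v))
    (G G' : functor (wprod v) (wprod w))
    (b : nattrans G G') (a : nattrans F F'), P (Cell2 b) (Cell2 a)) ->
  forall b a, cod2 a = dom2 b -> P b a.
Proof. by move=> Pba [v w G G' b] [u v' F F' a] /= e; subst v'. Qed.

Lemma dom1_comp G F : cod1 F = dom1 G -> dom1 (comp1 G F) = dom1 F.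
Proof. by move: G F; apply: comp1_ind => *; rewrite comp1E. Qed.

Lemma cod1_comp G F : cod1 F = dom1 G -> cod1 (comp1 G F) = cod1 G.
Proof. by move: G F; apply: comp1_ind => *; rewrite comp1E. Qed.

Lemma src2_vcomp b a : tgt2 a = src2 b -> src2 (vcomp b a) = src2 a.
Proof. by move: b a; apply: vcomp_ind => *; rewrite vcompE. Qed.

Lemma tgt2_vcomp b a : tgt2 a = src2 b -> tgt2 (vcomp b a) = tgt2 b.
Proof. by move: b a; apply: vcomp_ind => *; rewrite vcompE. Qed.

Lemma src2_hcomp b a :
  cod2 a = dom2 b -> src2 (hcomp b a) = comp1 (src2 b) (src2 a).
Proof. by move: b a; apply: hcomp_ind => *; rewrite hcompE comp1E. Qed.

Lemma tgt2_hcomp b a :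
  cod2 a = dom2 b -> tgt2 (hcomp b a) = comp1 (tgt2 b) (tgt2 a).
Proof. by move: b a; apply: hcomp_ind => *; rewrite hcompE comp1E. Qed.

Lemma src2_id F : src2 (id2 F) = F. Proof. by case: F. Qed.
Lemma tgt2_id F : tgt2 (id2 F) = F. Proof. by case: F. Qed.

Record arrow (C : category) := Arrow {
  adom : C;
  acod : C;
  amap : hom adom acod
}.
Arguments Arrow {C adom acod}.

Definition farrow (C D : category) (F : functor C D) (f : arrow C) : arrow D :=
  Arrow (fmap F (amap f)).

Definition narrow (C D : category) (F G : functor C D) (a : nattrans F G)
  (f : arrow C) : arrow D := Arrow (a (adom f)).

Definition acast v w (e : v = w) : arrow (wprod v) -> arrow (wprod w) :=
  ecast x (arrow (wprod v) -> arrow (wprod x)) e id.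

Lemma acast1 v (e : v = v) f : acast e f = f.
Proof. by rewrite (Prop_irrelevance e erefl). Qed.

Lemma Arrow_inj (C : category) (a b : C) (f g : hom a b) :
  Arrow f = Arrow g -> f = g.
Proof.
pose P (x : C * C) := hom x.1 x.2.
move/(congr1 (fun c => existT P (adom c, acod c) (amap c))).
exact: (@existT_inj2 _ P).
Qed.

Lemma Arrow_cmp (C : category) (a b c a' b' c' : C) (g : hom b c)
    (f : hom a b) (g' : hom b' c') (f' : hom a' b') :
  Arrow g = Arrow g' -> Arrow f = Arrow f' -> Arrow (cmp g f) = Arrow (cmp g' f').
Proof.
move=> eg ef.
have ea := congr1 (@adom _) ef; have eb := congr1 (@adom _) eg.
have ec := congr1 (@acod _) eg.
move: ea eb ec => /= ea eb ec; subst a' b' c'.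
by rewrite (Arrow_inj eg) (Arrow_inj ef).
Qed.

Lemma functor_ext (C D : category) (F G : functor C D) :
  farrow F =1 farrow G -> F = G.
Proof.
move=> FG.
have FGo : fobj F =1 fobj G.
  by move=> a; exact: (congr1 (@adom _) (FG (Arrow (idm a)))).
case: F G FG FGo => [Fo Fm F1 FM] [Go Gm G1 GM] /= FG /funext FGo.
subst Go.
have FGm : Fm = Gm.
  apply: functional_extensionality_dep => a.
  apply: functional_extensionality_dep => b.
  apply: functional_extensionality_dep => f.
  exact: (Arrow_inj (FG (Arrow f))).
subst Gm.
by rewrite (Prop_irrelevance F1 G1) (Prop_irrelevance FM GM).
Qed.

Lemma nattrans_ext (C D : category) (F G : functor C D) (a b : nattrans F G) :
  narrow a =1 narrow b -> a = b.
Proof.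
move=> ab; have {}ab c : a c = b c.
  exact: (Arrow_inj (ab (Arrow (idm c)))).
case: a b ab => [a aN] [b bN] /= ab.
have {}ab : a = b by apply: functional_extensionality_dep.
by subst b; rewrite (Prop_irrelevance aN bN).
Qed.

Lemma Cell1_ext u v u' v' (F : functor (wprod u) (wprod v))
    (F' : functor (wprod u') (wprod v')) (eu : u = u') (ev : v = v') :
  (forall f, acast ev (farrow F f) = farrow F' (acast eu f)) ->
  Cell1 F = Cell1 F'.
Proof.
subst u' v' => FF'; congr Cell1.
by apply: functor_ext => f; exact: FF'.
Qed.

Lemma Cell2_ext u v u' v' (F G : functor (wprod u) (wprod v))
    (F' G' : functor (wprod u') (wprod v'))
    (a : nattrans F G) (a' : nattrans F' G') (eu : u = u') (ev : v = v') :
  (forall f, acast ev (farrow F f) = farrow F' (acast eu f)) ->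
  (forall f, acast ev (farrow G f) = farrow G' (acast eu f)) ->
  (forall f, acast ev (narrow a f) = narrow a' (acast eu f)) ->
  Cell2 a = Cell2 a'.
Proof.
subst u' v' => /= FF' GG'.
have eF : F = F' by apply: functor_ext.
have eG : G = G' by apply: functor_ext.
by subst F' G' => aa'; congr Cell2; apply: nattrans_ext.
Qed.

Definition acons C w (f : arrow C) (g : arrow (wprod w)) :
    arrow (wprod (C :: w)) :=
  @Arrow (wprod (C :: w)) (adom f, adom g) (acod f, acod g) (amap f, amap g).

Lemma aconsP C w (h : arrow (wprod (C :: w))) :
  exists f g, h = acons f g.
Proof.
by case: h => -[a1 a2] [b1 b2] /= [f1 f2]; exists (Arrow f1), (Arrow f2).
Qed.

Lemma acast_cons C v w (e : v = w) (e' : C :: v = C :: w) f g :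
  acast e' (acons f g) = acons f (acast e g).
Proof. by subst w; rewrite !acast1. Qed.

Definition afst v w : arrow (wprod (v ++ w)) -> arrow (wprod v) :=
  farrow (wfst v w).
Definition asnd v w : arrow (wprod (v ++ w)) -> arrow (wprod w) :=
  farrow (wsnd v w).
Definition apair v w (f : arrow (wprod v)) (g : arrow (wprod w)) :
  arrow (wprod (v ++ w)) := Arrow (wpair_map (amap f) (amap g)).
Arguments afst {v w}.
Arguments asnd {v w}.

Lemma arrow0 (f g : arrow (wprod [::])) : f = g.
Proof. by case: f g => -[] [] [] [[] [] []]. Qed.

Lemma afst_pair v w (f : arrow (wprod v)) (g : arrow (wprod w)) :
  afst (apair f g) = f.
Proof.
elim: v f => [|C v IH] f; first exact: arrow0.
have [f1 [f2 ->]] := aconsP f.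
by rewrite -[in RHS](IH f2).
Qed.

Lemma asnd_pair v w (f : arrow (wprod v)) (g : arrow (wprod w)) :
  asnd (apair f g) = g.
Proof.
elim: v f => [|C v IH] f; first by case: g.
have [f1 [f2 ->]] := aconsP f.
by rewrite -[in RHS](IH f2).
Qed.

Lemma apairK v w (h : arrow (wprod (v ++ w))) : apair (afst h) (asnd h) = h.
Proof.
elim: v h => [|C v IH] h; first by case: h.
have [h1 [h2 ->]] := @aconsP C (v ++ w) h.
by rewrite -[in RHS](IH h2).
Qed.

Lemma apair0 w f (g : arrow (wprod w)) : @apair [::] w f g = g.
Proof. by case: g. Qed.

Lemma acast_pair0 v f g (e : v ++ [::] = v) : acast e (apair f g) = f.
Proof.
elim: v f e => [|C v IH] f e; first exact: arrow0.
have [f1 [f2 ->]] := aconsP f.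
rewrite -[in RHS](IH f2 (cats0 v)).
exact: (@acast_cons C (v ++ [::]) v (cats0 v) e f1 (apair f2 g)).
Qed.

Lemma acast_pairA u v w f g h (e : u ++ v ++ w = (u ++ v) ++ w) :
  acast e (apair f (apair g h)) = apair (apair f g) h.
Proof.
elim: u f e => [|C u IH] f e.
  by rewrite acast1 [LHS]apair0 [apair f g]apair0.
have [f1 [f2 ->]] := aconsP f.
transitivity (acons f1 (apair (apair f2 g) h)); last by [].
rewrite -(IH f2 (catA u v w)).
refine (@acast_cons C (u ++ v ++ w) ((u ++ v) ++ w) (catA u v w) e f1 (apair f2 (apair g h))).
Qed.

Lemma farrow_tens v v' w w' (F : functor (wprod v) (wprod v'))
    (G : functor (wprod w) (wprod w')) f g :
  farrow (ftens F G) (apair f g) = apair (farrow F f) (farrow G g).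
Proof.
set z := apair f g.
transitivity (apair (farrow F (afst z)) (farrow G (asnd z))); first by [].
by rewrite afst_pair asnd_pair.
Qed.

Lemma narrow_tens v v' w w' (F F' : functor (wprod v) (wprod v'))
    (G G' : functor (wprod w) (wprod w'))
    (a : nattrans F F') (b : nattrans G G') f g :
  narrow (ntens a b) (apair f g) = apair (narrow a f) (narrow b g).
Proof.
set z := apair f g.
transitivity (apair (narrow a (afst z)) (narrow b (asnd z))); first by [].
by rewrite afst_pair asnd_pair.
Qed.

Lemma tens1_id v w : tens1 (id1 v) (id1 w) = id1 (v ++ w).
Proof.
congr Cell1; apply: functor_ext => f.
by rewrite -(apairK f) farrow_tens.
Qed.

Lemma tens1A F G H : tens1 F (tens1 G H) = tens1 (tens1 F G) H.
Proof.
apply: Cell1_ext; try exact: catA; move=> eu ev f.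
rewrite -(apairK f) -(apairK (asnd f)) acast_pairA !farrow_tens.
exact: acast_pairA.
Qed.

Lemma tens1_idl F : tens1 (id1 [::]) F = F.
Proof.
case: F => u v F; apply: (@Cell1_ext _ _ _ _ _ _ erefl erefl) => f.
by rewrite !acast1.
Qed.

Lemma tens1_idr F : tens1 F (id1 [::]) = F.
Proof.
case: F => u v F; apply: Cell1_ext; try exact: cats0; move=> eu ev f.
by rewrite -(apairK f) farrow_tens !acast_pair0.
Qed.

Lemma tens2_id F G : tens2 (id2 F) (id2 G) = id2 (tens1 F G).
Proof.
congr Cell2; apply: nattrans_ext => f.
by rewrite /narrow /= wpair_map1.
Qed.

Lemma tens2A a b c : tens2 a (tens2 b c) = tens2 (tens2 a b) c.
Proof.
apply: Cell2_ext; try exact: catA; move=> eu ev f;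
  rewrite -(apairK f) -(apairK (asnd f)) acast_pairA
    ?(farrow_tens, narrow_tens); exact: acast_pairA.
Qed.

Lemma tens2_idl a : tens2 (id2 (id1 [::])) a = a.
Proof.
case: a => u v F G a.
apply: (@Cell2_ext _ _ _ _ _ _ _ _ _ _ erefl erefl) => f;
  by rewrite !acast1.
Qed.

Lemma tens2_idr a : tens2 a (id2 (id1 [::])) = a.
Proof.
case: a => u v F G a; apply: Cell2_ext; try exact: cats0; move=> eu ev f;
  by rewrite -(apairK f) ?(farrow_tens, narrow_tens) !acast_pair0.
Qed.

Lemma tens1_comp G F G' F' : cod1 F = dom1 G -> cod1 F' = dom1 G' ->
  tens1 (comp1 G F) (comp1 G' F') = comp1 (tens1 G G') (tens1 F F').
Proof.
move=> e e'; move: G F e G' F' e'.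
apply: comp1_ind => u v w G F; apply: comp1_ind => u' v' w' G' F'.
rewrite !comp1E; congr Cell1; apply: functor_ext => f.
rewrite -(apairK f) farrow_tens.
transitivity (farrow (ftens G G') (farrow (ftens F F') (apair (afst f) (asnd f)))).
  by rewrite !farrow_tens.
by [].
Qed.

Lemma tens2_vcomp b a b' a' : tgt2 a = src2 b -> tgt2 a' = src2 b' ->
  tens2 (vcomp b a) (vcomp b' a') = vcomp (tens2 b b') (tens2 a a').
Proof.
move=> e e'; move: b a e b' a' e'.
apply: vcomp_ind => u v F G H b a; apply: vcomp_ind => u' v' F' G' H' b' a'.
rewrite !vcompE; congr Cell2; apply: nattrans_ext => f.
by rewrite /narrow /= wpair_mapM.
Qed.

Lemma tens2_hcomp b a b' a' : cod2 a = dom2 b -> cod2 a' = dom2 b' ->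
  tens2 (hcomp b a) (hcomp b' a') = hcomp (tens2 b b') (tens2 a a').
Proof.
move=> e e'; move: b a e b' a' e'.
apply: hcomp_ind => u v w F F1 G G1 b a.
apply: hcomp_ind => u' v' w' F' F1' G' G1' b' a'.
rewrite !hcompE.
apply: (@Cell2_ext _ _ _ _ _ _ _ _ _ _ erefl erefl) => f; rewrite !acast1.
- have := @tens1_comp (Cell1 G) (Cell1 F) (Cell1 G') (Cell1 F') erefl erefl.
  by rewrite !comp1E => /Cell1_inj /= ->.
- have := @tens1_comp (Cell1 G1) (Cell1 F1) (Cell1 G1') (Cell1 F1') erefl erefl.
  by rewrite !comp1E => /Cell1_inj /= ->.
set x := wfst_obj (adom f); set y := wsnd_obj (adom f).
transitivity (Arrow (wpair_map (cmp (fmap G1 (a x)) (b (F x)))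
                               (cmp (fmap G1' (a' y)) (b' (F' y))))); first by [].
rewrite wpair_mapM; apply: Arrow_cmp.
- exact/esym/(farrow_tens G1 G1' (Arrow (a x)) (Arrow (a' y))).
- exact/esym/(narrow_tens b b' (Arrow (idm (F x))) (Arrow (idm (F' y)))).
Qed.

(** Order-preserving maps [m] -> [n]; the set [n] is ['I_n.+1]. *)
Record delta m n := Delta {
  dfun :> 'I_m.+1 -> 'I_n.+1;
  dleq : forall i j : 'I_m.+1, i <= j -> dfun i <= dfun j
}.

Lemma delta_ext m n (f g : delta m n) : f =1 g -> f = g.
Proof.
case: f g => [f hf] [g hg] /= /funext fg; subst g.
by rewrite (Prop_irrelevance hf hg).
Qed.

Definition did m : delta m m := @Delta m m (fun i => i) (fun _ _ h => h).

Definition dcomp k m n (g : delta m n) (f : delta k m) : delta k n :=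
  @Delta k n (fun i => g (f i)) (fun _ _ h => dleq g (dleq f h)).

Definition dconst m : delta m 0 := @Delta m 0 (fun=> ord0) (fun _ _ _ => leqnn 0).

Record sset := Sset {
  scar :> nat -> Type;
  sact : forall m n, delta m n -> scar n -> scar m;
  sact_id : forall n (x : scar n), sact (did n) x = x;
  sact_comp : forall k m n (g : delta m n) (f : delta k m) (x : scar n),
    sact f (sact g x) = sact (dcomp g f) x
}.
Arguments sact {s m n}.

Record smap (X Y : sset) := Smap {
  smapf :> forall n, X n -> Y n;
  smapN : forall m n (t : delta m n) (x : X n),
    smapf (sact t x) = sact t (smapf x)
}.

Definition smap_comp (X Y Z : sset) (g : smap Y Z) (f : smap X Y) : smap X Z.
Proof. by exists (fun n x => g n (f n x)) => m n t x; rewrite !smapN. Defined.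

Lemma smap_ext (X Y : sset) (f g : smap X Y) :
  (forall n (x : X n), f n x = g n x) -> f = g.
Proof.
case: f g => [f hf] [g hg] /= fg.
have {}fg : f = g.
  by apply: functional_extensionality_dep => n; apply/funext => x.
by subst g; rewrite (Prop_irrelevance hf hg).
Qed.

(** The codegeneracy sigma_k : [n+1] -> [n], hitting k twice. *)
Lemma codegen_lt n (k : 'I_n.+1) (i : 'I_n.+2) : unbump k i < n.+1.
Proof.
rewrite /unbump; case: (ltnP k i) => [ki|ik] /=.
  by rewrite subn1 -ltnS (ltn_predK ki).
by rewrite subn0 (leq_ltn_trans ik).
Qed.

Lemma codegen_le n (k : 'I_n.+1) (i j : 'I_n.+2) :
  i <= j -> unbump k i <= unbump k j.
Proof.
rewrite /unbump => ij; case: (ltnP k i) => [ki|ik] /=.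
  by rewrite (leq_trans ki ij) leq_sub2r.
case: (ltnP k j) => [kj|jk] /=; last by rewrite !subn0.
by rewrite subn0 subn1 (leq_trans ik) // -ltnS (ltn_predK kj).
Qed.

Definition codegen n (k : 'I_n.+1) : delta n.+1 n :=
  @Delta n.+1 n (fun i => Ordinal (codegen_lt k i)) (@codegen_le n k).

Definition sdeg (X : sset) n (k : 'I_n.+1) (x : X n) : X n.+1 :=
  sact (codegen k) x.

Inductive degenerate (X : sset) : forall n, X n -> Prop :=
  Degenerate n (k : 'I_n.+1) (y : X n) : degenerate (sdeg k y).

(** The increasing enumeration delta_C : [#|C| - 1] -> [n] of C; it takes
junk values only if C is empty. *)
Definition subset_nth n (C : {set 'I_n.+1}) (i : 'I_(#|C|.-1).+1) : 'I_n.+1 :=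
  nth ord0 (enum C) i.

Lemma sorted_enum_set n (C : {set 'I_n}) : sorted (fun i j : 'I_n => i <= j) (enum C).
Proof.
rewrite {1}/enum_mem; apply: sorted_filter; first by move=> ? ? ?; exact: leq_trans.
rewrite -enumT -(@sorted_map _ _ (val : 'I_n -> nat) leq) val_enum_ord.
exact: iota_sorted.
Qed.

Lemma subset_nth_le n (C : {set 'I_n.+1}) (i j : 'I_(#|C|.-1).+1) :
  i <= j -> subset_nth i <= subset_nth j.
Proof.
move=> ij; rewrite /subset_nth.
case: (posnP #|C|) => [C0|C0].
  have s0 : size (enum C) = 0 by rewrite -cardE.
  by rewrite !nth_default ?s0.
have lt (k : 'I_(#|C|.-1).+1) : k < size (enum C).
  by rewrite -cardE (leq_trans (ltn_ord k)) ?prednK.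
apply: (@sorted_leq_nth _ (fun i j : 'I_n.+1 => i <= j)) => //.
- by move=> ? ? ?; exact: leq_trans.
- exact: sorted_enum_set.
- exact: lt.
- exact: lt.
Qed.

Definition subset_map n (C : {set 'I_n.+1}) : delta #|C|.-1 n :=
  Delta (@subset_nth_le n C).

(** x_C *)
Definition face (X : sset) n (x : X n) (C : {set 'I_n.+1}) : X #|C|.-1 :=
  sact (subset_map C) x.

(** [edge x p q] is x_{p,q}; the map sorts its arguments, to be total. *)
Lemma edge_map_le n (p q : 'I_n.+1) (i j : 'I_2) : i <= j ->
  (if i == ord0 then if p <= q then p else q else if p <= q then q else p) <=
  (if j == ord0 then if p <= q then p else q else if p <= q then q else p).
Proof.
have -> k : (k == ord0 :> 'I_2) = (k == 0 :> nat) by [].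
case: eqP => [->|/eqP i0].
  by case: eqP => // _ _; case: (leqP p q) => [//|/ltnW].
by case: eqP => // -> ; rewrite leqn0 (negPf i0).
Qed.

Definition edge_map n (p q : 'I_n.+1) : delta 1 n := Delta (edge_map_le p q).

Definition edge (X : sset) n (x : X n) (p q : 'I_n.+1) : X 1 :=
  sact (edge_map p q) x.

Definition itv n (a b : 'I_n.+1) : {set 'I_n.+1} := [set i : 'I_n.+1 | a <= i <= b].

Definition ends n : {set 'I_n.+1} := [set ord0; ord_max].

(** The pairs (c, c^+) for c in C^-, in increasing order. *)
Definition steps n (C : {set 'I_n.+1}) : seq ('I_n.+1 * 'I_n.+1) :=
  zip (enum C) (behead (enum C)).

(** Composition is in diagrammatic order: in [N2Cat], where it is the product,
a composite p -> q -> r becomes (value on p -> q) x (value on q -> r). *)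
Record scat := Scat {
  sobj :> Type;
  shom : sobj -> sobj -> sset;
  sidm : forall a, shom a a 0;
  scmp : forall a b c m, shom a b m -> shom b c m -> shom a c m;
  scmpN : forall a b c m n (t : delta m n) (f : shom a b n) (g : shom b c n),
    sact t (scmp f g) = scmp (sact t f) (sact t g);
  scmp1m : forall a b m (f : shom a b m),
    scmp (sact (dconst m) (sidm a)) f = f;
  scmpm1 : forall a b m (f : shom a b m),
    scmp f (sact (dconst m) (sidm b)) = f;
  scmpA : forall a b c d m (f : shom a b m) (g : shom b c m) (h : shom c d m),
    scmp f (scmp g h) = scmp (scmp f g) h
}.
Arguments shom {_}.
Arguments sidm {_}.
Arguments scmp {_ a b c m}.

Record sfun (U V : scat) := Sfun {
  sfobj :> U -> V;
  sfhom : forall a b, smap (shom a b) (shom (sfobj a) (sfobj b));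
  sfhom1 : forall a, sfhom a a 0 (sidm a) = sidm (sfobj a);
  sfhomM : forall a b c m (f : shom a b m) (g : shom b c m),
    sfhom a c m (scmp f g) = scmp (sfhom a b m f) (sfhom b c m g)
}.
Arguments sfhom {U V} _ {a b}.

Definition sfcomp (U V W : scat) (G : sfun V W) (F : sfun U V) : sfun U W.
Proof.
exists (fun a => G (F a)) (fun a b => smap_comp (sfhom G) (sfhom F)).
- by move=> a /=; rewrite !sfhom1.
- by move=> a b c m f g /=; rewrite !sfhomM.
Defined.

Lemma sfun_ext (U V : scat) (F : sfun U V)
    (h : forall a b, smap (shom a b) (shom (F a) (F b))) h1 hM :
  (forall a b m (f : shom a b m), h a b m f = sfhom F m f) ->
  @Sfun U V F h h1 hM = F.
Proof.
case: F h h1 hM => Fo Fh F1 FM h h1 hM /= hF.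
have eh : h = Fh.
  apply: functional_extensionality_dep => a.
  by apply: functional_extensionality_dep => b; exact: smap_ext.
by subst h; rewrite (Prop_irrelevance h1 F1) (Prop_irrelevance hM FM).
Qed.

(** An m-simplex of S[n](p, q) is a functor from [m] to the opposite of the poset
of subsets of [p, q] containing p and q; the chain C_0 <= ... <= C_m is the
simplex whose i-th vertex is C_(m-i). *)

Record chain n (p q : 'I_n.+1) m := Chain {
  cset :> 'I_m.+1 -> {set 'I_n.+1};
  csetS : forall i j : 'I_m.+1, i <= j -> cset j \subset cset i;
  cset_min : forall i, p \in cset i;
  cset_max : forall i, q \in cset i;
  cset_itv : forall i, cset i \subset itv p q
}.

Lemma chain_ext n (p q : 'I_n.+1) m (C D : chain p q m) : C =1 D -> C = D.
Proof.
case: C D => [C C1 C2 C3 C4] [D D1 D2 D3 D4] /= /funext CD; subst D.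
by rewrite (Prop_irrelevance C1 D1) (Prop_irrelevance C2 D2)
  (Prop_irrelevance C3 D3) (Prop_irrelevance C4 D4).
Qed.

Definition chain_act n (p q : 'I_n.+1) l m (t : delta l m) (C : chain p q m) :
  chain p q l.
Proof.
exists (fun i => C (t i)).
- by move=> i j ij; apply: csetS; exact: dleq.
- by move=> i; exact: cset_min.
- by move=> i; exact: cset_max.
- by move=> i; exact: cset_itv.
Defined.

Definition chain_sset n (p q : 'I_n.+1) : sset.
Proof.
by exists (chain p q) (@chain_act n p q) => *; exact: chain_ext.
Defined.

Definition chain_id n (p : 'I_n.+1) : chain p p 0.
Proof.
exists (fun=> [set p]) => *; rewrite ?set11 //.
by rewrite sub1set inE leqnn.
Defined.

Definition chain_comp n (p q r : 'I_n.+1) m (C : chain p q m) (D : chain q r m) :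
  chain p r m.
Proof.
exists (fun i => C i :|: D i).
- by move=> i j ij; rewrite setUSS ?csetS.
- by move=> i; rewrite inE cset_min.
- by move=> i; rewrite inE cset_max orbT.
move=> i; have := subsetP (cset_itv C i) _ (cset_min C i).
have := subsetP (cset_itv D i) _ (cset_max D i).
rewrite !inE => /andP[qr _] /andP[_ pq].
apply/subsetP => s; rewrite !inE.
case/orP => [/(subsetP (cset_itv C i))|/(subsetP (cset_itv D i))].
  by rewrite inE => /andP[-> /leq_trans->].
by rewrite inE => /andP[/(leq_trans pq)-> ->].
Defined.

Definition simplex_scat (n : nat) : scat.
Proof.
exists 'I_n.+1 (@chain_sset n) (@chain_id n) (@chain_comp n).
- by move=> *; exact: chain_ext.
- move=> p q m C; apply: chain_ext => i /=.
  by apply/setUidPr; rewrite sub1set (cset_min C).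
- move=> p q m C; apply: chain_ext => i /=.
  by apply/setUidPl; rewrite sub1set (cset_max C).
- by move=> p q r s m C D E; apply: chain_ext => i /=; rewrite setUA.
Defined.

Definition chain_image m n (t : delta m n) (p q : 'I_m.+1) k (C : chain p q k) :
  chain (t p) (t q) k.
Proof.
exists (fun i => t @: C i).
- by move=> i j ij; rewrite imsetS ?csetS.
- by move=> i; rewrite imset_f ?cset_min.
- by move=> i; rewrite imset_f ?cset_max.
move=> i; apply/subsetP => _ /imsetP[s sC ->].
by have /[!inE]/andP[ps sq] := subsetP (cset_itv C i) s sC; rewrite !dleq.
Defined.

Definition simplex_sfun m n (t : delta m n) :
  sfun (simplex_scat m) (simplex_scat n).
Proof.
unshelve refine (@Sfun (simplex_scat m) (simplex_scat n) t _ _ _).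
- move=> p q; exists (fun k => @chain_image m n t p q k).
  by move=> k l u C; exact: chain_ext.
- by move=> p; apply: chain_ext => i /=; rewrite imset_set1.
- by move=> p q r k C D; apply: chain_ext => i /=; rewrite imsetU.
Defined.

Definition hc_nerve (U : scat) : sset.
Proof.
exists (fun n => sfun (simplex_scat n) U)
  (fun m n t L => sfcomp L (simplex_sfun t)).
- move=> n L; apply: sfun_ext => p q m C /=.
  by congr (sfhom L _ _); apply: chain_ext => i /=; rewrite imset_id.
- move=> k m n g f L.
  apply: (@sfun_ext _ _ (sfcomp L (simplex_sfun (dcomp g f)))) => p q l C /=.
  by congr (sfhom L _ _); apply: chain_ext => i /=; rewrite -imset_comp.
Defined.

(** An m-simplex of N_2(Cat) is a family of categories, functors and natural transformations
eta_ijk : T_jk o T_ij => T_ik satisfying the 3-simplex equation.  A simplex of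
the coskeleton is determined by its faces of dimension at most 3, so one
definition covers all m.  The families are indexed by weakly increasing indices,
with the values at repeated indices forced to be identities, so that the
simplicial structure, degeneracies included, is reindexing. *)

Record n2_simplex m := N2Simplex {
  n2ob : 'I_m.+1 -> word;
  n2fun : forall i j : 'I_m.+1, i <= j -> cell1;
  n2nat : forall i j k : 'I_m.+1, i <= j -> j <= k -> cell2;
  n2dom : forall (i j : 'I_m.+1) (ij : i <= j), dom1 (n2fun ij) = n2ob i;
  n2cod : forall (i j : 'I_m.+1) (ij : i <= j), cod1 (n2fun ij) = n2ob j;
  n2fun_id : forall (i : 'I_m.+1) (ii : i <= i), n2fun ii = id1 (n2ob i);
  n2src : forall (i j k : 'I_m.+1) (ij : i <= j) (jk : j <= k),
    src2 (n2nat ij jk) = comp1 (n2fun jk) (n2fun ij);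
  n2tgt : forall (i j k : 'I_m.+1) (ij : i <= j) (jk : j <= k) (ik : i <= k),
    tgt2 (n2nat ij jk) = n2fun ik;
  n2nat_idl : forall (i j : 'I_m.+1) (ii : i <= i) (ij : i <= j),
    n2nat ii ij = id2 (n2fun ij);
  n2nat_idr : forall (i j : 'I_m.+1) (ij : i <= j) (jj : j <= j),
    n2nat ij jj = id2 (n2fun ij);
  n2coh : forall (i j k l : 'I_m.+1) (ij : i <= j) (jk : j <= k) (kl : k <= l)
      (ik : i <= k) (jl : j <= l),
    vcomp (n2nat ij jl) (hcomp (n2nat jk kl) (id2 (n2fun ij))) =
    vcomp (n2nat ik kl) (hcomp (id2 (n2fun kl)) (n2nat ij jk))
}.

Lemma n2_ext m (s t : n2_simplex m) :
  (forall i, n2ob s i = n2ob t i) ->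
  (forall (i j : 'I_m.+1) (ij : i <= j), n2fun s ij = n2fun t ij) ->
  (forall (i j k : 'I_m.+1) (ij : i <= j) (jk : j <= k), n2nat s ij jk = n2nat t ij jk) ->
  s = t.
Proof.
case: s t => [so sf sn s1 s2 s3 s4 s5 s6 s7 s8] [to tf tn t1 t2 t3 t4 t5 t6 t7 t8].
move=> /= /funext eo ef en; subst to.
have {}ef : sf = tf.
  apply: functional_extensionality_dep => i.
  apply: functional_extensionality_dep => j.
  exact: functional_extensionality_dep.
subst tf.
have {}en : sn = tn.
  apply: functional_extensionality_dep => i.
  apply: functional_extensionality_dep => j.
  apply: functional_extensionality_dep => k.
  apply: functional_extensionality_dep => ij.
  exact: functional_extensionality_dep.
subst tn.
by congr N2Simplex; exact: Prop_irrelevance.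
Qed.

Lemma n2fun_irr m (s : n2_simplex m) (i j : 'I_m.+1) (h h' : i <= j) :
  n2fun s h = n2fun s h'.
Proof. by rewrite (bool_irrelevance h h'). Qed.

Lemma n2nat_irr m (s : n2_simplex m) (i j k : 'I_m.+1)
    (h h' : i <= j) (g g' : j <= k) :
  n2nat s h g = n2nat s h' g'.
Proof. by rewrite (bool_irrelevance h h') (bool_irrelevance g g'). Qed.

Definition n2_act m n (t : delta m n) (s : n2_simplex n) : n2_simplex m.
Proof.
exists (fun i => n2ob s (t i)) (fun i j ij => n2fun s (dleq t ij))
  (fun i j k ij jk => n2nat s (dleq t ij) (dleq t jk)).
- by move=> *; exact: n2dom.
- by move=> *; exact: n2cod.
- by move=> *; exact: n2fun_id.
- by move=> *; exact: n2src.
- by move=> *; exact: n2tgt.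
- by move=> *; exact: n2nat_idl.
- by move=> *; exact: n2nat_idr.
- by move=> *; exact: n2coh.
Defined.

Definition n2_sset : sset.
Proof.
exists n2_simplex n2_act.
- move=> n s; apply: n2_ext => [//|i j ij|i j k ij jk].
  + exact: (@n2fun_irr n s i j).
  + exact: (@n2nat_irr n s i j k).
- move=> k m n g f s; apply: n2_ext => [//|i j ij|i j l ij jl].
  + exact: (@n2fun_irr n s (g (f i)) (g (f j))).
  + exact: (@n2nat_irr n s (g (f i)) (g (f j)) (g (f l))).
Defined.

Lemma dom2E a : dom2 a = dom1 (src2 a). Proof. by []. Qed.
Lemma cod2E a : cod2 a = cod1 (tgt2 a). Proof. by []. Qed.

Lemma n2cod2 m (s : n2_simplex m) (i j k : 'I_m.+1) (ij : i <= j) (jk : j <= k) :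
  cod2 (n2nat s ij jk) = n2ob s k.
Proof. by rewrite cod2E (n2tgt _ _ _ (leq_trans ij jk)) n2cod. Qed.

Lemma n2dom2 m (s : n2_simplex m) (i j k : 'I_m.+1) (ij : i <= j) (jk : j <= k) :
  dom2 (n2nat s ij jk) = n2ob s i.
Proof.
by rewrite -[LHS]/(dom1 (tgt2 (n2nat s ij jk))) (n2tgt _ _ _ (leq_trans ij jk)) n2dom.
Qed.

Lemma n2_compable m (s : n2_simplex m) (i j k : 'I_m.+1) (ij : i <= j) (jk : j <= k) :
  cod1 (n2fun s ij) = dom1 (n2fun s jk).
Proof. by rewrite n2cod n2dom. Qed.

Lemma n2_hcompable_l m (s : n2_simplex m) (i j k l : 'I_m.+1)
    (ij : i <= j) (jk : j <= k) (kl : k <= l) :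
  cod2 (id2 (n2fun s ij)) = dom2 (n2nat s jk kl).
Proof. by rewrite n2dom2 /= n2cod. Qed.

Lemma n2_hcompable_r m (s : n2_simplex m) (i j k l : 'I_m.+1)
    (ij : i <= j) (jk : j <= k) (kl : k <= l) :
  cod2 (n2nat s ij jk) = dom2 (id2 (n2fun s kl)).
Proof. by rewrite n2cod2 /= n2dom. Qed.

Lemma n2_vcompable_l m (s : n2_simplex m) (i j k l : 'I_m.+1)
    (ij : i <= j) (jk : j <= k) (kl : k <= l) (jl : j <= l) :
  tgt2 (hcomp (n2nat s jk kl) (id2 (n2fun s ij))) = src2 (n2nat s ij jl).
Proof.
by rewrite tgt2_hcomp ?(n2_hcompable_l s ij jk kl) // (n2tgt _ _ _ jl) tgt2_id n2src.
Qed.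

Lemma n2_vcompable_r m (s : n2_simplex m) (i j k l : 'I_m.+1)
    (ij : i <= j) (jk : j <= k) (kl : k <= l) (ik : i <= k) :
  tgt2 (hcomp (id2 (n2fun s kl)) (n2nat s ij jk)) = src2 (n2nat s ik kl).
Proof.
by rewrite tgt2_hcomp ?(n2_hcompable_r s ij jk kl) // (n2tgt _ _ _ ik) tgt2_id n2src.
Qed.

Lemma comp1_id w : comp1 (id1 w) (id1 w) = id1 w.
Proof. by rewrite comp1E; congr Cell1; exact: functor_ext. Qed.

Lemma hcomp_id w : hcomp (id2 (id1 w)) (id2 (id1 w)) = id2 (id1 w).
Proof.
rewrite hcompE.
apply: (@Cell2_ext _ _ _ _ _ _ _ _ _ _ erefl erefl) => f; rewrite !acast1 //.
by rewrite /narrow /= cmp1m.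
Qed.

Definition n2_unit : n2_simplex 0.
Proof.
exists (fun=> [::]) (fun _ _ _ => id1 [::]) (fun _ _ _ _ _ => id2 (id1 [::])) => //.
by move=> *; rewrite comp1_id.
Defined.

Definition n2_tens m (s t : n2_simplex m) : n2_simplex m.
Proof.
exists (fun i => n2ob s i ++ n2ob t i)
  (fun i j ij => tens1 (n2fun s ij) (n2fun t ij))
  (fun i j k ij jk => tens2 (n2nat s ij jk) (n2nat t ij jk)).
- by move=> i j ij; rewrite /= !n2dom.
- by move=> i j ij; rewrite /= !n2cod.
- by move=> i ii; rewrite !n2fun_id tens1_id.
- move=> i j k ij jk; rewrite -[LHS]/(tens1 (src2 _) (src2 _)) !n2src.
  by rewrite tens1_comp //; exact: n2_compable.
- move=> i j k ij jk ik; rewrite -[LHS]/(tens1 (tgt2 _) (tgt2 _)).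
  by rewrite !(n2tgt _ _ _ ik).
- by move=> i j ii ij; rewrite !n2nat_idl tens2_id.
- by move=> i j ij jj; rewrite !n2nat_idr tens2_id.
- move=> i j k l ij jk kl ik jl.
  rewrite -!tens2_id -!tens2_hcomp ?(n2_hcompable_l _ ij jk kl)
    ?(n2_hcompable_r _ ij jk kl) //.
  rewrite -!tens2_vcomp ?n2_vcompable_l ?n2_vcompable_r //.
  by rewrite !(n2coh _ ij jk kl ik jl).
Defined.

Definition N2Cat : scat.
Proof.
exists unit (fun _ _ => n2_sset) (fun=> n2_unit) (fun _ _ _ m s t => n2_tens s t).
- by move=> *; exact: n2_ext.
- move=> _ _ m s; apply: n2_ext => [i|i j ij|i j k ij jk].
  + by [].
  + exact: tens1_idl.
  + exact: tens2_idl.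
- move=> _ _ m s; apply: n2_ext => [i|i j ij|i j k ij jk].
  + exact: cats0.
  + exact: tens1_idr.
  + exact: tens2_idr.
- move=> _ _ _ _ m s t u; apply: n2_ext => [i|i j ij|i j k ij jk].
  + exact: catA.
  + exact: tens1A.
  + exact: tens2A.
Defined.

Definition n2_cat (s : n2_simplex 0) : word := n2ob s ord0.

Definition n2_functor (s : n2_simplex 1) : cell1 :=
  @n2fun 1 s (@Ordinal 2 0 isT) (@Ordinal 2 1 isT) isT.

Definition n2_nattrans (s : n2_simplex 2) : cell2 :=
  @n2nat 2 s (@Ordinal 3 0 isT) (@Ordinal 3 1 isT) (@Ordinal 3 2 isT) isT isT.

(** The chains {0,n}, {0,n} <= [n] and {0,n} <= C <= [n] in S[n](0, n).  The
largest set is the vertex 0. *)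

Lemma sub_itv_full n (C : {set 'I_n.+1}) : C \subset itv ord0 ord_max.
Proof. by apply/subsetP => i _; rewrite inE leq0n leq_ord. Qed.

Lemma nth_subset (T : finType) (s : seq {set T}) i j :
  sorted (fun C D : {set T} => D \subset C) s -> i <= j ->
  nth set0 s j \subset nth set0 s i.
Proof.
move=> s_sorted ij; case: (ltnP j (size s)) => [js|/(nth_default _)->]; last first.
  exact: sub0set.
apply: (@sorted_leq_nth _ (fun C D : {set T} => D \subset C)) => //.
- by move=> C D E DC ED; exact: subset_trans ED DC.
- exact: leq_ltn_trans ij js.
Qed.

Definition chain_ends n : chain (@ord0 n) ord_max 0.
Proof.
exists (fun=> ends n) => // *; rewrite ?inE ?eqxx ?orbT //.
exact: sub_itv_full.
Defined.

Definition chain_full n : chain (@ord0 n) ord_max 1.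
Proof.
exists (fun i => nth set0 [:: [set: 'I_n.+1]; ends n] i).
- by move=> i j; apply: nth_subset; rewrite /= subsetT.
- by case=> [[|[|]]] //= _; rewrite !inE ?eqxx.
- by case=> [[|[|]]] //= _; rewrite !inE ?eqxx ?orbT.
- by move=> i; exact: sub_itv_full.
Defined.

Definition chain_mid n (C : {set 'I_n.+1}) (endsC : ends n \subset C) :
  chain (@ord0 n) ord_max 2.
Proof.
exists (fun i => nth set0 [:: [set: 'I_n.+1]; C; ends n] i).
- by move=> i j; apply: nth_subset; rewrite /= subsetT endsC.
- by case=> [[|[|[|]]]] //= _; rewrite ?(subsetP endsC) ?inE ?eqxx.
- by case=> [[|[|[|]]]] //= _; rewrite ?(subsetP endsC) ?inE ?eqxx ?orbT.
- by move=> i; exact: sub_itv_full.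
Defined.

(** The last lemma below shows that no default value of [comp1] is involved in
the composites T^{x_C} o prod_c T^{x_[c,c^+]}. *)

Lemma subset_nth_mem n (C : {set 'I_n.+1}) i : 0 < #|C| -> @subset_nth n C i \in C.
Proof.
move=> C0; rewrite -mem_enum mem_nth // -cardE.
by rewrite (leq_trans (ltn_ord i)) ?prednK.
Qed.

Lemma subset_nth_index n (C : {set 'I_n.+1}) a :
  a \in C -> exists i, a = @subset_nth n C i.
Proof.
move=> aC; have iC : index a (enum C) < #|C| by rewrite cardE index_mem mem_enum.
have iC1 : index a (enum C) < #|C|.-1.+1 by rewrite (ltn_predK iC).
by exists (Ordinal iC1); rewrite /subset_nth nth_index ?mem_enum.
Qed.

Lemma subset_nth_min n (C : {set 'I_n.+1}) a :
  a \in C -> (forall b, b \in C -> a <= b) -> @subset_nth n C ord0 = a.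
Proof.
move=> aC a_min; apply/val_inj/eqP; rewrite eqn_leq a_min ?andbT; last first.
  by rewrite subset_nth_mem // card_gt0; apply/set0Pn; exists a.
have [i ->] := subset_nth_index aC; exact: (@subset_nth_le _ C ord0 i).
Qed.

Lemma subset_nth_max n (C : {set 'I_n.+1}) b :
  b \in C -> (forall a, a \in C -> a <= b) -> @subset_nth n C ord_max = b.
Proof.
move=> bC b_max; apply/val_inj/eqP; rewrite eqn_leq b_max //=; last first.
  by rewrite subset_nth_mem // card_gt0; apply/set0Pn; exists b.
have [i {1}->] := subset_nth_index bC.
by apply: (@subset_nth_le _ C i ord_max); rewrite leq_ord.
Qed.

Lemma edge_face (X : sset) n (x : X n) (C : {set 'I_n.+1})
    (p q : 'I_(#|C|.-1).+1) : p <= q ->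
  edge (face x C) p q = edge x (subset_nth p) (subset_nth q).
Proof.
move=> pq; rewrite /edge /face sact_comp; congr sact; apply: delta_ext => i /=.
by rewrite pq subset_nth_le //; case: ifP.
Qed.

Lemma edge_face_itv (X : sset) n (x : X n) (a b : 'I_n.+1) : a <= b ->
  edge (face x (itv a b)) ord0 ord_max = edge x a b.
Proof.
move=> ab; rewrite edge_face //; congr edge.
  by apply: subset_nth_min => [|c]; rewrite inE ?leqnn // => /andP[].
by apply: subset_nth_max => [|c]; rewrite inE ?leqnn ?andbT // => /andP[].
Qed.

Lemma card_itv_gt1 n (a b : 'I_n.+1) : a < b -> 0 < #|itv a b|.-1.
Proof.
move=> ab; rewrite -ltnS (@leq_trans #|[set a; b]|) //.
  by rewrite cards2 neq_ltn ab.
rewrite (leq_trans (subset_leq_card (_ : _ \subset itv a b))) ?leqSpred //.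
by apply/subsetP => c; rewrite !inE => /orP[] /eqP ->; rewrite leqnn ltnW.
Qed.

Lemma size_steps n (C : {set 'I_n.+1}) : size (steps C) = #|C|.-1.
Proof. by rewrite size_zip size_behead -cardE; apply/minn_idPr; rewrite leq_pred. Qed.

Lemma nth_steps n (C : {set 'I_n.+1}) a i : i < #|C|.-1 ->
  nth a (steps C) i = (nth ord0 (enum C) i, nth ord0 (enum C) i.+1).
Proof.
move=> iC; rewrite (set_nth_default (ord0, ord0)) ?size_steps //.
by rewrite nth_zip_cond size_steps iC /= nth_behead.
Qed.

Lemma steps_lt n (C : {set 'I_n.+1}) c : c \in steps C -> c.1 < c.2.
Proof.
move=> cC; have iC : index c (steps C) < #|C|.-1 by rewrite -size_steps index_mem.
rewrite -(nth_index c cC) nth_steps //=.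
have i1C : (index c (steps C)).+1 < size (enum C).
  by rewrite -cardE (leq_trans (_ : _ <= #|C|.-1.+1)) // (ltn_predK (leq_trans iC (leq_pred _))).
rewrite ltn_neqAle; apply/andP; split.
  by rewrite (inj_eq val_inj) nth_uniq ?enum_uniq ?(ltnW i1C) // neq_ltn leqnn.
apply: (@sorted_leq_nth _ (fun i j : 'I_n.+1 => i <= j)) => //.
- by move=> ? ? ?; exact: leq_trans.
- exact: sorted_enum_set.
- exact: ltnW.
Qed.

Lemma steps_composable (X : sset) (A : X 1 -> word) (T : forall n, X n -> cell1) :
  (forall n (x : X n), 0 < n -> dom1 (T n x) =
     \big[cat/[::]]_(i < n) A (edge x (widen_ord (leqnSn n) i) (lift ord0 i))) ->
  (forall n (x : X n), 0 < n -> cod1 (T n x) = A (edge x ord0 ord_max)) ->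
  forall n (x : X n) (C : {set 'I_n.+1}), 0 < n -> ends n \subset C ->
  cod1 (\big[tens1/id1 [::]]_(c <- steps C) T _ (face x (itv c.1 c.2))) =
  dom1 (T _ (face x C)).
Proof.
move=> T_dom T_cod n x C n0 endsC.
have C0 : 0 < #|C|.-1.
  rewrite -ltnS (@leq_trans #|ends n|) //; first by rewrite cards2 -val_eqE /= eq_sym -lt0n n0.
  by rewrite (leq_trans (subset_leq_card endsC)) ?leqSpred.
rewrite (big_morph cod1 (id1 := [::]) (op1 := cat)) // T_dom //.
rewrite (big_nth (ord0, ord0)) size_steps big_mkord; apply: eq_bigr => i _.
have cC : nth (ord0, ord0) (steps C) i \in steps C by rewrite mem_nth ?size_steps.
have lt_c := steps_lt cC.
rewrite (T_cod _ _ (card_itv_gt1 lt_c)) (edge_face_itv x (ltnW lt_c)).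
by rewrite nth_steps //= edge_face //=.
Qed.

(* Main.v *)
(** A chain B <= C <= D of S[n](p, q) is the composite, over the steps (b, b^+)
of B, of its restrictions to the intervals [b, b^+], and each restriction is the
image of a chain {0,m} <= C' <= [m] under a face map.  So the values
phi_m(y)({0,m} <= C' <= [m]) = eta^y_C' determine phi, as products over steps,
and the 3-simplex equation of phi_n(x)({0,n} <= A <= B <= [n]) is the displayed
identity.

Conversely, take these products as the definition of phi.  They are natural
because a map of ordinals is a surjection followed by a face map, and surjections
only insert identities, by (1.a), (2.b) and (3.b).  The 3-simplex equation holds
if it does on each step, where it is the displayed identity for a face of x.
Invariance under surjections reduces it to non-degenerate simplices, and it is
trivial when one of the inclusions is an equality. *)

From HB Require Import structures.
Require Import Defs.
From mathcomp Require Import all_boot boolp.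

Set Implicit Arguments.
Unset Strict Implicit.
Unset Printing Implicit Defensive.

(** * Monoids of 1-cells and of 2-cells under the product *)

#[warnings="-redundant-canonical-projection"]
HB.instance Definition _ := Monoid.isLaw.Build cell1 (id1 [::]) tens1
  tens1A tens1_idl tens1_idr.
#[warnings="-redundant-canonical-projection"]
HB.instance Definition _ := Monoid.isLaw.Build cell2 (id2 (id1 [::])) tens2
  tens2A tens2_idl tens2_idr.

(** * Sets spanning an interval, and their steps *)

Section Steps.
Variable n : nat.
Implicit Types (C D : {set 'I_n.+1}) (a b c p q r : 'I_n.+1).

(** Such a [C] is a vertex of the mapping space S[n](a, b). The inequality [a <= b] is not a
    separate clause, since [a \in itv a b] forces it. *)
Definition spans a b C := [&& a \in C, b \in C & C \subset itv a b].

Lemma spansP a b C :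
  reflect [/\ a \in C, b \in C & forall c, c \in C -> a <= c <= b] (spans a b C).
Proof.
apply: (iffP and3P) => -[aC bC] h; split=> //.
  by move=> c /(subsetP h); rewrite inE.
by apply/subsetP => c /h; rewrite inE.
Qed.

Lemma spans_le a b C : spans a b C -> a <= b.
Proof. by case/spansP => aC _ /(_ a aC) /andP[]. Qed.

Lemma spans_itv c d C : c \in C -> d \in C -> c <= d ->
  spans c d (C :&: itv c d).
Proof.
move=> cC dC cd; apply/spansP; split; rewrite ?inE ?cC ?dC ?leqnn ?cd //.
by move=> e; rewrite !inE => /andP[].
Qed.

Lemma spans_sub a b C D : spans a b D -> a \in C -> b \in C -> C \subset D ->
  spans a b C.
Proof.
by move=> /and3P[_ _ Dab] aC bC CD; rewrite /spans aC bC (subset_trans CD).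
Qed.

Lemma spans_cap a b C : spans a b C -> C :&: itv a b = C.
Proof. by case/and3P => _ _ /setIidPl. Qed.

Lemma spans1 a C : spans a a C -> C = [set a].
Proof.
case/spansP => aC _ h; apply/setP => c; rewrite inE; apply/idP/eqP => [/h|->//].
by move=> h'; apply/val_inj/eqP; rewrite eqn_leq andbC.
Qed.

Lemma card_spans a b C : spans a b C -> (1 < #|C|) = (a < b).
Proof.
move=> sC; have := spans_le sC; rewrite leq_eqVlt => /orP[/eqP/val_inj ab|ab].
  by rewrite -ab in sC *; rewrite (spans1 sC) cards1 !ltnn.
rewrite ab; case/spansP: sC => aC bC _; apply/card_gt1P; exists a, b; split=> //.
by rewrite -val_eqE neq_ltn ab.
Qed.

Lemma sorted_enum C : sorted (fun a b : 'I_n.+1 => a < b) (enum C).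
Proof.
have -> : (fun a b : 'I_n.+1 => a < b) = relpre val ltn by [].
rewrite -sorted_map ltn_sorted_uniq_leq map_inj_uniq ?enum_uniq; last exact: val_inj.
by rewrite sorted_map; exact: sorted_enum_set.
Qed.

Lemma enum_setE C (s : seq 'I_n.+1) :
  sorted (fun a b => a < b) s -> s =i C -> enum C = s.
Proof.
move=> ss sC; apply: (@irr_sorted_eq _ (fun a b : 'I_n.+1 => a < b)) => //.
- by move=> b a c; exact: ltn_trans.
- by move=> a; exact: ltnn.
- exact: sorted_enum.
- by move=> a; rewrite mem_enum sC.
Qed.

Lemma steps_set1 a : steps [set a] = [::].
Proof. by rewrite /steps enum_set1. Qed.

Lemma steps_set2 a b : a < b -> steps [set a; b] = [:: (a, b)].
Proof.
move=> ab; rewrite /steps (@enum_setE _ [:: a; b]) //=; first by rewrite ab.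
by move=> c; rewrite !inE.
Qed.

(** The point [b] ends one enumeration and starts the other, so pairing each entry with its
    successor cuts there without losing or repeating a step. The half-open pieces [s1] and [s2] keep
    [b] from being listed twice. *)
Lemma steps_cat a b c C : a <= b -> b <= c -> b \in C ->
  steps (C :&: itv a c) = steps (C :&: itv a b) ++ steps (C :&: itv b c).
Proof.
move=> ab bc bC.
pose s1 := [seq d : 'I_n.+1 <- enum C | a <= d < b].
pose s2 := [seq d : 'I_n.+1 <- enum C | b < d <= c].
have lt_tr : transitive (fun a b : 'I_n.+1 => a < b) by move=> ? ? ?; exact: ltn_trans.
have s1s : pairwise (fun a b : 'I_n.+1 => a < b) s1.
  by rewrite -sorted_pairwise //; apply: sorted_filter => //; exact: sorted_enum.
have s2s : pairwise (fun a b : 'I_n.+1 => a < b) s2.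
  by rewrite -sorted_pairwise //; apply: sorted_filter => //; exact: sorted_enum.
have mem1 d : (d \in s1) = (d \in C) && (a <= d < b) by rewrite mem_filter mem_enum andbC.
have mem2 d : (d \in s2) = (d \in C) && (b < d <= c) by rewrite mem_filter mem_enum andbC.
have b2 : all (fun d : 'I_n.+1 => b < d) s2 by apply/allP => d; rewrite mem2 => /and3P[].
have b1 : all (fun d : 'I_n.+1 => d < b) s1 by apply/allP => d; rewrite mem1 => /and3P[].
have e1 : enum (C :&: itv a b) = rcons s1 b.
  apply: enum_setE.
    by rewrite sorted_pairwise // -cats1 pairwise_cat s1s allrel1r b1.
  move=> d; rewrite mem_rcons !inE mem1.
  case: (eqVneq d b) => [->|db] /=; first by rewrite bC ab leqnn.
  by rewrite [d < b]ltn_neqAle db.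
have e2 : enum (C :&: itv b c) = b :: s2.
  apply: enum_setE; first by rewrite sorted_pairwise //= b2.
  move=> d; rewrite !inE mem2.
  case: (eqVneq d b) => [->|db] /=; first by rewrite bC bc leqnn.
  by rewrite [b < d]ltn_neqAle eq_sym db.
have e3 : enum (C :&: itv a c) = s1 ++ b :: s2.
  apply: enum_setE.
    rewrite sorted_pairwise // pairwise_cat /= s1s b2 s2s !andbT.
    rewrite allrel_consr b1 /=; apply/allrelP => d e /(allP b1) db /(allP b2).
    exact: ltn_trans.
  move=> d; rewrite mem_cat !inE mem1 mem2.
  case: (eqVneq d b) => [->|db] /=; first by rewrite orbT bC ab bc.
  rewrite -andb_orr; congr andb.
  case: (ltngtP d b) => [lt|gt|/val_inj e]; last by rewrite e eqxx in db.
    by rewrite orbF (leq_trans (ltnW lt) bc).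
  by rewrite andbF (leq_trans ab (ltnW gt)).
rewrite /steps e1 e2 e3; elim: s1 {s1s mem1 b1 e1 e3} => [|d [|e s1] IH] //=.
by rewrite IH.
Qed.

Lemma steps_mem C (c : 'I_n.+1 * 'I_n.+1) : c \in steps C -> c.1 \in C /\ c.2 \in C.
Proof.
rewrite -[c.1 \in C]mem_enum -[c.2 \in C]mem_enum /steps.
case: (enum C) => [|a s] //= cs; split; last first.
  rewrite inE; apply/orP; right.
  have : c.2 \in unzip2 (zip (a :: s) s) by apply/mapP; exists c.
  by rewrite unzip2_zip //= ltnW.
have : c.1 \in unzip1 (zip (a :: s) s) by apply/mapP; exists c.
by move=> h; apply: (mem_subseq _ h);
  elim: s a {cs h} => [|b s IH] a /=; rewrite ?eqxx; [|exact: IH].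
Qed.

Lemma steps_itv C (c : 'I_n.+1 * 'I_n.+1) :
  c \in steps C -> C :&: itv c.1 c.2 = [set c.1; c.2].
Proof.
move=> cC; have [c1 c2] := steps_mem cC; have lt_c := steps_lt cC.
apply/setP => d; rewrite !inE; apply/idP/idP; last first.
  by case/orP => /eqP ->; rewrite ?c1 ?c2 leqnn (ltnW lt_c).
case/and3P => dC; rewrite leq_eqVlt => /orP[/eqP/val_inj->|c1d]; first by rewrite eqxx.
rewrite leq_eqVlt => /orP[/eqP/val_inj->|dc2]; first by rewrite eqxx orbT.
(* [d] now lies strictly between two consecutive entries of [enum C], so its index would lie
   strictly between two consecutive numbers. *)
exfalso.
have iC : index c (steps C) < #|C|.-1 by rewrite -size_steps index_mem.
have := nth_index c cC; rewrite nth_steps //.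
set i := index c _ in iC * => ec; rewrite -ec /= in c1d dc2.
have jC : index d (enum C) < size (enum C) by rewrite index_mem mem_enum.
have i1C : i.+1 < size (enum C).
  rewrite -cardE (leq_trans (_ : _ <= #|C|.-1.+1)) //.
  by rewrite (ltn_predK (leq_trans iC (leq_pred _))).
rewrite -(nth_index ord0 (_ : d \in enum C)) ?mem_enum // in c1d dc2.
have mono j k : j < size (enum C) -> k < size (enum C) ->
    nth ord0 (enum C) j < nth ord0 (enum C) k -> j < k.
  move=> jC' kC'; apply: contraTltn => kj; rewrite -leqNgt.
  apply: (@sorted_leq_nth _ (fun i j : 'I_n.+1 => i <= j)) => //.
  - by move=> ? ? ?; exact: leq_trans.
  - exact: sorted_enum_set.
have := mono _ _ (ltnW i1C) jC c1d; have := mono _ _ jC i1C dc2.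
by rewrite ltnS leqNgt => /negP.
Qed.

(** Induction on the cardinality: removing [a] leaves a set that spans from the successor [c] of [a]
    to [b]. The premises [a < c] and [C :&: itv a c = [set a; c]] say that [c] is that successor. *)
Lemma spans_ind (P : 'I_n.+1 -> 'I_n.+1 -> {set 'I_n.+1} -> Prop) :
  (forall a, P a a [set a]) ->
  (forall a b c C, spans a b C -> c \in C -> a < c ->
     C :&: itv a c = [set a; c] -> P c b (C :&: itv c b) -> P a b C) ->
  forall a b C, spans a b C -> P a b C.
Proof.
move=> P1 PS a b C; have [k] := ubnP #|C|; elim: k a C => // k IH a C /ltnSE Ck sC.
have := spans_le sC; rewrite leq_eqVlt => /orP[/eqP/val_inj ab|ab].
  by rewrite -ab in sC *; rewrite (spans1 sC); exact: P1.
case/spansP: (sC) => aC bC Cab.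
(* The successor of [a] is the least element of [C] above it; [b] shows that there is one. *)
case: (@arg_minnP _ b (fun c => (c \in C) && (a < c)) val).
  by rewrite bC.
move=> c /andP[cC ac] cmin.
have cb : c <= b by case/andP: (Cab c cC).
apply: (PS a b c C) => //.
  apply/setP => d; rewrite !inE; apply/idP/idP; last first.
    by case/orP => /eqP ->; rewrite ?aC ?cC leqnn (ltnW ac).
  case/and3P => dC; rewrite leq_eqVlt => /orP[/eqP/val_inj->|ad]; first by rewrite eqxx.
  move=> dc; apply/orP; right; apply/eqP/val_inj/eqP; rewrite eqn_leq dc /=.
  by apply: cmin; rewrite dC.
apply: IH; last exact: spans_itv.
apply: leq_trans Ck; apply: proper_card; apply/properP; split; first exact: subsetIl.
by exists a => //; rewrite !inE aC /= leqNgt ac.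
Qed.

(** Points of [C] belong to [D], so no step of [D] crosses one: each lies in exactly one step
    interval of [C]. This regroups a product over a fine set along a coarser one. *)
Lemma big_steps_refine (R : Type) (idx : R) (op : Monoid.law idx)
    (F : 'I_n.+1 * 'I_n.+1 -> R) a b C D :
  spans a b C -> spans a b D -> C \subset D ->
  \big[op/idx]_(c <- steps C) \big[op/idx]_(d <- steps (D :&: itv c.1 c.2)) F d =
  \big[op/idx]_(d <- steps D) F d.
Proof.
move=> sC; elim/spans_ind: a b C / sC D => [a|a b c C sC cC ac Cac IH] D sD CD.
  by rewrite (spans1 sD) steps_set1 !big_nil.
have cD := subsetP CD _ cC; have cb : c <= b by case/spansP: sC => _ _ /(_ c cC)/andP[].
have bD : b \in D by case/and3P: sD.
rewrite -(spans_cap sC) (steps_cat (ltnW ac) cb cC) Cac steps_set2 // big_cat big_seq1 /=.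
rewrite -[in RHS](spans_cap sD) (steps_cat (ltnW ac) cb cD) big_cat; congr (op _ _).
rewrite -IH ?setSI ?spans_itv //.
rewrite big_seq [RHS]big_seq; apply: eq_bigr => d /steps_mem[].
rewrite !inE => /and3P[_ cd1 d1b] /and3P[_ cd2 d2b].
congr bigop; congr steps; apply/setP => e; rewrite !inE -!andbA; congr andb.
apply/idP/idP => [/andP[de ed]|/and4P[_ _ -> ->]//].
by rewrite de ed (leq_trans cd1 de) (leq_trans ed d2b).
Qed.

End Steps.

Lemma spans_step n (C D : {set 'I_n.+1}) (c : 'I_n.+1 * 'I_n.+1) : C \subset D ->
  c \in steps C -> spans c.1 c.2 (D :&: itv c.1 c.2).
Proof.
move=> CD cC; have [c1 c2] := steps_mem cC.
by apply: spans_itv; rewrite ?(subsetP CD) // ltnW // (steps_lt cC).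
Qed.

Lemma cap_step n (C D : {set 'I_n.+1}) (c d : 'I_n.+1 * 'I_n.+1) :
  d \in steps (C :&: itv c.1 c.2) ->
  D :&: itv d.1 d.2 = (D :&: itv c.1 c.2) :&: itv d.1 d.2.
Proof.
move=> /steps_mem[]; rewrite !inE => /and3P[_ cd1 d1c] /and3P[_ cd2 d2c].
apply/setP => e; rewrite !inE -!andbA; congr andb.
apply/idP/idP => [/andP[de ed]|/and4P[_ _ -> ->]//].
by rewrite de ed (leq_trans cd1 de) (leq_trans ed d2c).
Qed.

Lemma steps_setT n (F : 'I_n.+1 * 'I_n.+1 -> word) :
  \big[cat/[::]]_(c <- steps [set: 'I_n.+1]) F c =
  \big[cat/[::]]_(i < n) F (widen_ord (leqnSn n) i, lift ord0 i).
Proof.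
have cT : #|[set: 'I_n.+1]|.-1 = n by rewrite cardsT card_ord.
rewrite (big_nth (ord0, ord0)) size_steps big_mkord cT; apply: eq_bigr => i _.
have nthE (j : 'I_n.+1) : nth ord0 (enum [set: 'I_n.+1]) j = j.
  by rewrite enum_setT -enumT nth_ord_enum.
rewrite nth_steps ?cT //; congr (F (_, _)).
  exact: nthE (widen_ord (leqnSn n) i).
exact: nthE (lift ord0 i).
Qed.

Lemma steps_spans n (p q : 'I_n.+1) C (c : 'I_n.+1 * 'I_n.+1) :
  spans p q C -> c \in steps C -> p <= c.1 /\ c.2 <= q.
Proof.
by case/spansP=> _ _ h /steps_mem[/h /andP[-> _] /h /andP[_ ->]].
Qed.

(** The two sets meet only at [q], where [steps_cat] cuts the union. Unions of composable chains
    thereby become concatenations of steps, hence products. *)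
Lemma steps_setU n (p q r : 'I_n.+1) C D : spans p q C -> spans q r D ->
  steps (C :|: D) = steps C ++ steps D.
Proof.
move=> sC sD; have pq := spans_le sC; have qr := spans_le sD.
have sCD : spans p r (C :|: D).
  case/spansP: sC => pC _ pqC; case/spansP: sD => _ rD qrD.
  apply/spansP; split; rewrite ?inE ?pC ?rD ?orbT // => c /setUP[/pqC|/qrD] /andP[].
    by move=> -> /leq_trans->.
  by move=> /(leq_trans pq)-> ->.
rewrite -(spans_cap sCD) (steps_cat pq qr); last first.
  by case/and3P: sC => _ qC _; rewrite inE qC.
case/spansP: sC => pC qC pqC; case/spansP: sD => qD rD qrD.
congr (steps _ ++ steps _); apply/setP => c; rewrite !inE; apply/idP/idP.
- case/andP=> /orP[//|/qrD /andP[qc _]] /andP[_ cq].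
  by rewrite (_ : c = q) //; apply/val_inj/eqP; rewrite eqn_leq cq.
- by move=> cC; rewrite cC pqC.
- case/andP=> /orP[/pqC /andP[_ cq]|//] /andP[qc _].
  by rewrite (_ : c = q) //; apply/val_inj/eqP; rewrite eqn_leq cq.
- by move=> cD; rewrite cD orbT qrD.
Qed.

(** [D] lies above [q], so it contributes to the interval at most the point [q], which [C] contains
    as well. *)
Lemma setU_itvl n (p q r a b : 'I_n.+1) (C D : {set 'I_n.+1}) : spans p q C ->
  spans q r D -> b <= q -> (C :|: D) :&: itv a b = C :&: itv a b.
Proof.
case/spansP=> _ qC _ /spansP[_ _ qrD] bq; apply/setP => c; rewrite !inE.
apply/idP/idP => [/and3P[/orP[->|/qrD /andP[qc _]] ac cb]|/andP[-> //]]; rewrite ac cb //.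
by rewrite (_ : c = q) ?qC //; apply/val_inj/eqP; rewrite eqn_leq (leq_trans cb).
Qed.

Lemma setU_itvr n (p q r a b : 'I_n.+1) (C D : {set 'I_n.+1}) : spans p q C ->
  spans q r D -> q <= a -> (C :|: D) :&: itv a b = D :&: itv a b.
Proof.
case/spansP=> _ _ pqC /spansP[qD _ _] qa; apply/setP => c; rewrite !inE.
apply/idP/idP => [/and3P[/orP[/pqC /andP[_ cq]|->] ac cb]|/andP[-> ->]];
  rewrite ?ac ?cb ?orbT //.
by rewrite (_ : c = q) ?qD //; apply/val_inj/eqP; rewrite eqn_leq cq (leq_trans qa).
Qed.

(** * Images of steps under maps of ordinals *)

(** A point of [D] outside the interval can land in the image interval only on [t a] or [t c], and
    there [a] or [c] replaces it; this is where the endpoints have to lie in [D]. *)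
Lemma imset_itv m n (t : delta m n) (D : {set 'I_m.+1}) (a c : 'I_m.+1) :
  a \in D -> c \in D -> a <= c ->
  t @: (D :&: itv a c) = (t @: D) :&: itv (t a) (t c).
Proof.
move=> aD cD ac; apply/setP => e; rewrite inE; apply/imsetP/andP.
  case=> d; rewrite !inE => /and3P[dD ad dc] ->.
  by split; [exact: imset_f | rewrite !dleq].
case=> /imsetP[d dD ->]; rewrite inE => /andP[ad dc].
case: (leqP a d) => [ad'|/ltnW da]; last first.
  exists a; first by rewrite !inE aD leqnn ac.
  by apply/val_inj/eqP; rewrite eqn_leq ad dleq.
case: (leqP d c) => [dc'|/ltnW cd].
  by exists d => //; rewrite !inE dD ad' dc'.
exists c; first by rewrite !inE cD leqnn ac.
by apply/val_inj/eqP; rewrite eqn_leq dc dleq.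
Qed.

Lemma spans_imset m n (t : delta m n) (a b : 'I_m.+1) (C : {set 'I_m.+1}) :
  spans a b C -> spans (t a) (t b) (t @: C).
Proof.
move=> /spansP[aC bC abC]; apply/spansP; split; try exact: imset_f.
by move=> _ /imsetP[c /abC /andP[ac cb] ->]; rewrite !dleq.
Qed.

(** A step of [C] either stays a step of the image or collapses to a point, and a collapsed step
    contributes the unit. This makes products over steps natural in the ordinal. *)
Lemma big_steps_imset (R : Type) (idx : R) (op : Monoid.law idx) m n
    (t : delta m n) (a b : 'I_m.+1) (C : {set 'I_m.+1})
    (F : 'I_n.+1 * 'I_n.+1 -> R) :
  spans a b C -> (forall c, F (c, c) = idx) ->
  \big[op/idx]_(c <- steps (t @: C)) F c =
  \big[op/idx]_(c <- steps C) F (t c.1, t c.2).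
Proof.
move=> sC Fid; elim/spans_ind: a b C / sC => [a|a b c C sC cC ac Cac IH].
  by rewrite imset_set1 !steps_set1 !big_nil.
have cb : c <= b by case/spansP: sC => _ _ /(_ c cC)/andP[].
have [aC bC _] := and3P sC.
rewrite -(spans_cap sC) imset_itv ?(spans_le sC) //.
rewrite (steps_cat (b := t c)) ?imset_f ?dleq ?(ltnW ac) //.
rewrite (steps_cat (b := c)) ?(ltnW ac) // Cac.
rewrite -!imset_itv ?(ltnW ac) // Cac !big_cat /= IH; congr (op _ _).
rewrite steps_set2 // big_seq1 imsetU1 imset_set1 /=.
have := dleq t (ltnW ac); rewrite leq_eqVlt => /orP[/eqP/val_inj->|tac].
  by rewrite setUid steps_set1 big_nil Fid.
by rewrite steps_set2 // big_seq1.
Qed.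

(** * Unit laws, and the interchange law for iterated products of cells *)

Lemma vcomp_idr b F : src2 b = F -> vcomp b (id2 F) = b.
Proof.
case: b => u v G H b <-; rewrite vcompE; congr Cell2.
by apply: nattrans_ext => f; rewrite /narrow /= cmpm1.
Qed.

Lemma vcomp_idl a F : tgt2 a = F -> vcomp (id2 F) a = a.
Proof.
case: a => u v G H a <-; rewrite vcompE; congr Cell2.
by apply: nattrans_ext => f; rewrite /narrow /= cmp1m.
Qed.

Lemma hcomp_id2 G F : cod1 F = dom1 G -> hcomp (id2 G) (id2 F) = id2 (comp1 G F).
Proof.
move: G F; apply: comp1_ind => u v w G F; rewrite hcompE comp1E /id2 /=; congr Cell2.
by apply: nattrans_ext => f; rewrite /narrow /= fmap1 cmp1m.
Qed.

Lemma hcomp_idr a w : dom2 a = w -> hcomp a (id2 (id1 w)) = a.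
Proof.
case: a => u v G H a /= <-; rewrite hcompE.
apply: (@Cell2_ext _ _ _ _ _ _ _ _ _ _ erefl erefl) => f; rewrite !acast1 //.
by rewrite /narrow /= fmap1 cmp1m.
Qed.

Lemma hcomp_idl a w : cod2 a = w -> hcomp (id2 (id1 w)) a = a.
Proof.
case: a => u v G H a /= <-; rewrite hcompE.
apply: (@Cell2_ext _ _ _ _ _ _ _ _ _ _ erefl erefl) => f; rewrite !acast1 //.
by rewrite /narrow /= cmpm1.
Qed.

Section BigTens.
Variables (I : eqType) (r : seq I).

Lemma dom1_tens F : dom1 (\big[tens1/id1 [::]]_(i <- r) F i) =
  \big[cat/[::]]_(i <- r) dom1 (F i).
Proof. exact: big_morph. Qed.

Lemma cod1_tens F : cod1 (\big[tens1/id1 [::]]_(i <- r) F i) =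
  \big[cat/[::]]_(i <- r) cod1 (F i).
Proof. exact: big_morph. Qed.

Lemma src2_tens a : src2 (\big[tens2/id2 (id1 [::])]_(i <- r) a i) =
  \big[tens1/id1 [::]]_(i <- r) src2 (a i).
Proof. exact: big_morph. Qed.

Lemma tgt2_tens a : tgt2 (\big[tens2/id2 (id1 [::])]_(i <- r) a i) =
  \big[tens1/id1 [::]]_(i <- r) tgt2 (a i).
Proof. exact: big_morph. Qed.

Lemma id1_tens w : \big[tens1/id1 [::]]_(i <- r) id1 (w i) =
  id1 (\big[cat/[::]]_(i <- r) w i).
Proof. by apply/esym/big_morph => // v v'; rewrite tens1_id. Qed.

Lemma id2_tens F : \big[tens2/id2 (id1 [::])]_(i <- r) id2 (F i) =
  id2 (\big[tens1/id1 [::]]_(i <- r) F i).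
Proof. by apply/esym/big_morph => // G H; rewrite tens2_id. Qed.

End BigTens.

Section BigComp.
Variables (I : eqType) (r : seq I).

(** The interchange law, iterated. Composability is asked at the entries of [r] only: when [r] lists
    the steps of a set, boundaries are known to match there, while elsewhere the partial
    compositions may return their default value. *)
Lemma comp1_tens F G : {in r, forall i, cod1 (F i) = dom1 (G i)} ->
  \big[tens1/id1 [::]]_(i <- r) comp1 (G i) (F i) =
  comp1 (\big[tens1/id1 [::]]_(i <- r) G i) (\big[tens1/id1 [::]]_(i <- r) F i).
Proof.
elim: r => [|i s IH] FG; first by rewrite !big_nil comp1_id.
have FGs : {in s, forall i, cod1 (F i) = dom1 (G i)}.
  by move=> j js; apply: FG; rewrite inE js orbT.
rewrite !big_cons IH // tens1_comp ?FG ?mem_head // cod1_tens dom1_tens.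
by rewrite !big_seq; apply: eq_bigr.
Qed.

Lemma vcomp_tens a b : {in r, forall i, tgt2 (a i) = src2 (b i)} ->
  \big[tens2/id2 (id1 [::])]_(i <- r) vcomp (b i) (a i) =
  vcomp (\big[tens2/id2 (id1 [::])]_(i <- r) b i)
    (\big[tens2/id2 (id1 [::])]_(i <- r) a i).
Proof.
elim: r => [|i s IH] ab; first by rewrite !big_nil vcomp_idr.
have abs : {in s, forall i, tgt2 (a i) = src2 (b i)}.
  by move=> j js; apply: ab; rewrite inE js orbT.
rewrite !big_cons IH // tens2_vcomp ?ab ?mem_head //.
by rewrite tgt2_tens src2_tens !big_seq; apply: eq_bigr.
Qed.

Lemma hcomp_tens a b : {in r, forall i, cod2 (a i) = dom2 (b i)} ->
  \big[tens2/id2 (id1 [::])]_(i <- r) hcomp (b i) (a i) =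
  hcomp (\big[tens2/id2 (id1 [::])]_(i <- r) b i)
    (\big[tens2/id2 (id1 [::])]_(i <- r) a i).
Proof.
elim: r => [|i s IH] ab; first by rewrite !big_nil hcomp_id.
have abs : {in s, forall i, cod2 (a i) = dom2 (b i)}.
  by move=> j js; apply: ab; rewrite inE js orbT.
rewrite !big_cons IH // tens2_hcomp ?ab ?mem_head //.
by rewrite (big_morph cod2 (id1 := [::]) (op1 := cat)) //
  (big_morph dom2 (id1 := [::]) (op1 := cat)) // !big_seq; apply: eq_bigr.
Qed.

End BigComp.

(** * Surjections of ordinals, face maps, and the epi-mono factorization *)

Definition dsurj m n (s : delta m n) := forall i, exists j, s j = i.

Lemma dsurj_imset m n (s : delta m n) :
  dsurj s -> s @: [set: 'I_m.+1] = [set: 'I_n.+1].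
Proof.
by move=> ss; apply/setP => i; rewrite inE; have [j <-] := ss i; rewrite imset_f.
Qed.

Lemma dsurj_leq m n (s : delta m n) : dsurj s -> n <= m.
Proof.
move=> /dsurj_imset h; suff : #|'I_n.+1| <= #|'I_m.+1| by rewrite !card_ord.
by rewrite -[#|'I_n.+1|]cardsT -h -[#|'I_m.+1|]cardsT leq_imset_card.
Qed.

Lemma dsurj0 m n (s : delta m n) : dsurj s -> s ord0 = ord0.
Proof.
move=> ss; have [j e] := ss ord0; apply/val_inj/eqP; rewrite eqn_leq leq0n andbT.
by have := @dleq _ _ s ord0 j (leq0n _); rewrite e.
Qed.

Lemma dsurj_max m n (s : delta m n) : dsurj s -> s ord_max = ord_max.
Proof.
move=> ss; have [j e] := ss ord_max; apply/val_inj/eqP.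
rewrite eqn_leq leq_ord /=.
by have := @dleq _ _ s j ord_max (leq_ord _); rewrite e.
Qed.

(** By finiteness [s] is injective, hence strictly increasing. It carries the increasing enumeration
    of [n] to an increasing enumeration of [n], which is the same list. *)
Lemma dsurj_id n (s : delta n n) : dsurj s -> s = did n.
Proof.
move=> ss; apply: delta_ext => i /=.
have s_inj : {in [set: 'I_n.+1] &, injective s} by apply/imset_injP; rewrite dsurj_imset.
have lt_s (a b : 'I_n.+1) : a < b -> s a < s b.
  move=> ab; rewrite ltn_neqAle dleq ?(ltnW ab) // andbT (inj_eq val_inj).
  by apply/negP => /eqP /s_inj e; move: ab; rewrite e ?inE // ltnn.
have e : enum [set: 'I_n.+1] = map s (enum [set: 'I_n.+1]).
  apply: enum_setE.
    by rewrite sorted_map; apply: sub_sorted (sorted_enum _) => a b; exact: lt_s.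
  move=> a; rewrite inE; apply/mapP; have [b <-] := ss a.
  by exists b; rewrite ?mem_enum ?inE.
have iE : i \in enum [set: 'I_n.+1] by rewrite mem_enum inE.
have := nth_map ord0 ord0 s (etrans (index_mem _ _) iE).
by rewrite -e nth_index.
Qed.

Lemma dsurj_codegen m n (s : delta m.+1 n) : dsurj s -> n < m.+1 ->
  exists k (s' : delta m n), dsurj s' /\ s = dcomp s' (codegen k).
Proof.
move=> ss nm.
(* Otherwise [s] increases strictly, so that every index is at most its value, and the last value is
   too large for [n]. *)
have [k sk] : exists k : 'I_m.+1, s (widen_ord (leqnSn _) k) = s (lift ord0 k).
  apply: contrapT => h.
  have lt_s (k : 'I_m.+1) : s (widen_ord (leqnSn _) k) < s (lift ord0 k).
    rewrite ltn_neqAle dleq /= ?leqnSn // andbT (inj_eq val_inj); apply/eqP => e.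
    by apply: h; exists k.
  have ge k (km : k < m.+2) : k <= s (Ordinal km).
    elim: k km => // k IH km; apply: leq_ltn_trans (IH (ltnW km)) _.
    have := lt_s (Ordinal (km : k < m.+1)).
    by congr (s _ < s _); apply/val_inj.
  have := ge _ (ltnSn m.+1); rewrite leqNgt => /negP; apply.
  by rewrite (leq_ltn_trans (leq_ord _)).
have le_lift (i j : 'I_m.+1) : i <= j -> bump k i <= bump k j.
  by rewrite leq_bump2.
(* The quotient is [s] restricted along the coface that skips [k], a section of [codegen k]; the
   value lost at [k] is still taken at its successor. *)
pose k' := widen_ord (leqnSn m.+1) k.
exists k, (@Delta m n (fun i => s (lift k' i))
  (fun i j ij => @dleq _ _ s (lift k' i) (lift k' j) (le_lift i j ij))); split.
  move=> i; have [j <-] := ss i.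
  case: (unliftP (widen_ord (leqnSn m.+1) k) j) => [j' ->|->]; first by exists j'.
  by exists k => /=; rewrite sk; congr (s _); apply/val_inj => /=; rewrite /bump leqnn.
apply: delta_ext => i /=.
case: (unliftP (widen_ord (leqnSn m.+1) k) i) => [j ->|->].
  by congr (s _); apply/val_inj; rewrite /= bumpK.
by rewrite sk; congr (s _); apply/val_inj; rewrite /= /unbump ltnn subn0 /bump leqnn.
Qed.

(** Codegeneracies generate the surjections; this extends (2.b) and (3.b) from single degeneracies
    to all surjections. *)
Lemma dsurj_ind (P : forall m n, delta m n -> Prop) :
  (forall n, P n n (did n)) ->
  (forall m n (k : 'I_m.+1) (s : delta m n), dsurj s -> P m n s ->
     P m.+1 n (dcomp s (codegen k))) ->
  forall m n (s : delta m n), dsurj s -> P m n s.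
Proof.
move=> P1 PS; elim=> [|m IH] n s ss.
  case: n s ss => [|n] s ss; last by have := dsurj_leq ss.
  by rewrite (dsurj_id ss).
have := dsurj_leq ss; rewrite leq_eqVlt => /orP[/eqP e|nm].
  by subst n; rewrite (dsurj_id ss).
have [k [s' [ss' ->]]] := dsurj_codegen ss nm.
exact: PS (IH _ _ ss').
Qed.

Lemma ends_spans n (C : {set 'I_n.+1}) : ends n \subset C = spans ord0 ord_max C.
Proof. by rewrite /spans sub_itv_full andbT /ends subUset !sub1set. Qed.

Lemma spans_setT n : spans ord0 ord_max [set: 'I_n.+1].
Proof. by rewrite -ends_spans subsetT. Qed.

Lemma subset_nth_inj n (C : {set 'I_n.+1}) : 0 < #|C| -> injective (@subset_nth n C).
Proof.
move=> C0 i j /eqP; rewrite nth_uniq ?enum_uniq //.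
- by move/eqP/val_inj.
- by rewrite -cardE (leq_trans (ltn_ord i)) // prednK.
- by rewrite -cardE (leq_trans (ltn_ord j)) // prednK.
Qed.

Lemma subset_map_imset n (C : {set 'I_n.+1}) :
  0 < #|C| -> subset_map C @: [set: 'I_(#|C|.-1).+1] = C.
Proof.
move=> C0; apply/setP => a; apply/imsetP/idP => [[i _ ->]|/subset_nth_index[i ->]].
  exact: subset_nth_mem.
by exists i.
Qed.

Lemma subset_map_preimset n (C D : {set 'I_n.+1}) : 0 < #|D| -> C \subset D ->
  subset_map D @: (subset_map D @^-1: C) = C.
Proof.
move=> D0 CD; have tD := subset_map_imset D0.
apply/setP => c; apply/imsetP/idP => [[d]|cC]; first by rewrite inE => dC ->.
have : c \in D by exact: (subsetP CD).
by rewrite -[in c \in D]tD => /imsetP[d _ e]; exists d; rewrite // inE -e.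
Qed.

Lemma imset_dcomp k m n (g : delta m n) (f : delta k m) (C : {set 'I_k.+1}) :
  dcomp g f @: C = g @: (f @: C).
Proof. exact: imset_comp. Qed.

(** The face map of the image is injective and monotone, so lifting [g] through it pointwise is
    monotone, and every point of the image is hit. The second factor has the form [subset_map] so
    that restriction along it is [face]. *)
Lemma delta_factor m n (g : delta m n) : exists s : delta m #|g @: [set: 'I_m.+1]|.-1,
  dsurj s /\ g = dcomp (subset_map (g @: [set: 'I_m.+1])) s.
Proof.
set D := g @: _.
have gD i : g i \in D by rewrite imset_f.
have D0 : 0 < #|D| by apply/card_gt0P; exists (g ord0).
have h i : exists j, subset_map D j == g i.
  by have [j ->] := subset_nth_index (gD i); exists j.
pose s i := xchoose (h i).
have sE i : subset_map D (s i) = g i by apply/eqP; exact: (xchooseP (h i)).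
have s_le (i j : 'I_m.+1) : i <= j -> s i <= s j.
  move=> ij; rewrite leqNgt; apply/negP => ji.
  have e : s i = s j.
    apply: (subset_nth_inj D0); apply/val_inj/eqP; rewrite eqn_leq.
    rewrite (subset_nth_le (ltnW ji)) andbT.
    by have := dleq g ij; rewrite -!sE.
  by rewrite e ltnn in ji.
exists (Delta s_le); split; last by apply: delta_ext => i; rewrite -sE.
move=> k; have : subset_map D k \in D by exact: subset_nth_mem.
by case/imsetP => i _ e; exists i; apply: (subset_nth_inj D0); rewrite [RHS]e -sE.
Qed.

Lemma subset_nth_spans n a b (D : {set 'I_n.+1}) : spans a b D ->
  @subset_nth n D ord0 = a /\ @subset_nth n D ord_max = b.
Proof.
case/spansP=> aD bD abD; split.
  by apply: subset_nth_min => // c /abD/andP[].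
by apply: subset_nth_max => // c /abD/andP[].
Qed.

(** The device that reduces statements on subsets [C] and [D] to the case where [D] is all of [m].
    Both [m] and [t] are existential, so [D] can be eliminated in favour of an image without
    occurring in the type of [t]. *)
Lemma subset_map_spans n a b (D : {set 'I_n.+1}) : spans a b D -> a < b ->
  exists m (t : delta m n), [/\ 0 < m, t ord0 = a /\ t ord_max = b,
    t @: [set: 'I_m.+1] = D & forall C, spans a b C -> C \subset D ->
      spans ord0 ord_max (t @^-1: C) /\ t @: (t @^-1: C) = C].
Proof.
move=> sD ab; have D1 : 1 < #|D| by rewrite (card_spans sD).
have tD := subset_map_imset (ltnW D1).
exists #|D|.-1, (subset_map D); split=> //; first by rewrite -subn1 subn_gt0.
  by rewrite /= (subset_nth_spans sD).1 (subset_nth_spans sD).2.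
move=> C /spansP[aC bC _] CD; split.
  rewrite -ends_spans subUset !sub1set !inE /=.
  by rewrite (subset_nth_spans sD).1 (subset_nth_spans sD).2 aC.
exact: subset_map_preimset (ltnW D1) CD.
Qed.

Lemma card_imset_le1 m n (t : delta m n) (D : {set 'I_m.+1}) :
  (1 < #|D|) = false -> (1 < #|t @: D|) = false.
Proof.
move/negbT; rewrite -leqNgt => D1; apply/negbTE; rewrite -leqNgt.
exact: leq_trans (leq_imset_card _ _) D1.
Qed.

Lemma itv1 n (D : {set 'I_n.+1}) c : (1 < #|D :&: itv c c|) = false.
Proof.
apply/negbTE; rewrite -leqNgt -(cards1 c); apply: subset_leq_card.
by apply/subsetP => d; rewrite !inE -eqn_leq => /andP[_ /eqP/val_inj->].
Qed.

Lemma codegen_surj n (k : 'I_n.+1) : dsurj (codegen k).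
Proof.
move=> i; exists (lift (widen_ord (leqnSn _) k) i).
by apply/val_inj; rewrite /= bumpK.
Qed.

Lemma ends_imset m n (s : delta m n) (C : {set 'I_m.+1}) :
  dsurj s -> ends m \subset C -> ends n \subset s @: C.
Proof.
move=> ss; rewrite !ends_spans => /(spans_imset s).
by rewrite dsurj0 // dsurj_max.
Qed.

(** (2.b) and (3.b) speak of simplices of positive dimension. A degeneracy of a vertex is therefore
    first brought down to dimension 1, where (1.a), (2.a) and (3.a) take over. *)
Lemma dconst_factor m : 0 < m ->
  exists s : delta m 1, dsurj s /\ dconst m = dcomp (codegen ord0) s.
Proof.
move=> m0.
have le (i j : 'I_m.+1) : i <= j -> (if i == ord0 then ord0 else ord_max : 'I_2) <=
    (if j == ord0 then ord0 else ord_max : 'I_2).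
  move=> ij; case: ifP => // i0; rewrite ifN //.
  by apply: contraFN i0 => /eqP j0; rewrite -val_eqE -leqn0 (leq_trans ij) ?j0.
exists (Delta le); split; last by apply: delta_ext => i; rewrite [LHS]ord1 [RHS]ord1.
case; case=> [|[|]] // h; first by exists ord0; apply/val_inj.
by exists ord_max; apply/val_inj; rewrite /= ifN // -val_eqE /= -lt0n.
Qed.

Lemma edge_act (X : sset) m n (t : delta m n) (x : X n) (a b : 'I_m.+1) : a <= b ->
  edge (sact t x) a b = edge x (t a) (t b).
Proof.
move=> ab; rewrite /edge sact_comp; congr sact; apply: delta_ext => i /=.
by rewrite ab dleq //; case: ifP.
Qed.

(** Induction on the dimension: every simplex is an iterated degeneracy of a non-degenerate one, the
    existence half of the Eilenberg-Zilber lemma. *)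
Lemma degenerate_case (X : sset) (P : forall n, X n -> Prop) :
  (forall n (x : X n), ~ degenerate x -> P n x) ->
  (forall n (k : 'I_n.+1) (y : X n), P n y -> P n.+1 (sdeg k y)) ->
  forall n (x : X n), P n x.
Proof.
move=> Pnd Pd n; have [m] := ubnP n; elim: m n => // m IH n /ltnSE nm x.
case: (pselect (degenerate x)) => [dx|]; last exact: Pnd.
by case: n x / dx nm => n k y nm; apply: Pd; apply: IH.
Qed.

(** * Chains, and extensionality of functors into N_2(Cat) *)

Lemma chain_spans n (p q : 'I_n.+1) m (C : chain p q m) i : spans p q (C i).
Proof. by rewrite /spans cset_min cset_max cset_itv. Qed.

(** Chains decrease with the index, so [C ord_max] is the smallest set and membership there gives
    membership in every set of the chain. *)
Definition chain_cap n (p q a b : 'I_n.+1) m (C : chain p q m)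
  (aC : a \in C ord_max) (bC : b \in C ord_max) (ab : a <= b) : chain a b m.
Proof.
exists (fun i => C i :&: itv a b).
- by move=> i j ij; rewrite setSI ?csetS.
- move=> i; rewrite !inE leqnn ab.
  by rewrite (subsetP (@csetS _ _ _ _ C i ord_max (leq_ord i))).
- move=> i; rewrite !inE leqnn ab.
  by rewrite (subsetP (@csetS _ _ _ _ C i ord_max (leq_ord i))).
- by move=> i; exact: subsetIr.
Defined.

(** The 3-simplex whose coherence equation becomes the displayed identity. *)
Definition chain_flag n (C D : {set 'I_n.+1}) (eC : ends n \subset C)
  (CD : C \subset D) : chain (@ord0 n) ord_max 3.
Proof.
exists (fun i => nth set0 [:: [set: 'I_n.+1]; D; C; ends n] i).
- by move=> i j; apply: nth_subset; rewrite /= subsetT CD eC.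
- by case=> [[|[|[|[|]]]]] //= _;
    rewrite ?(subsetP (subset_trans eC CD)) ?(subsetP eC) ?inE ?eqxx.
- by case=> [[|[|[|[|]]]]] //= _;
    rewrite ?(subsetP (subset_trans eC CD)) ?(subsetP eC) ?inE ?eqxx ?orbT.
- by move=> i; exact: sub_itv_full.
Defined.

(** Restriction along this map extracts the 2-simplex on the vertices [i], [j], [k]; repeated
    vertices are allowed. *)
Definition pick3 m (i j k : 'I_m.+1) (ij : i <= j) (jk : j <= k) : delta 2 m.
Proof.
exists (fun l : 'I_3 => nth i [:: i; j; k] l).
by case; case=> [|[|[|]]] // h; case; case=> [|[|[|]]] // h' _ /=; apply: leq_trans ij jk.
Defined.

(** Mapping spaces of N_2(Cat) do not depend on the objects; the type ascription uses this to
    compare values before the object maps are identified, which the single object then allows. *)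
Lemma sfun_N2Cat_ext n (F G : sfun (simplex_scat n) N2Cat) :
  (forall (p q : 'I_n.+1) m (C : chain p q m), 
     @sfhom _ _ F p q m C = @sfhom _ _ G p q m C :> n2_simplex m) -> F = G.
Proof.
case: F G => [Fo Fh F1 FM] [Go Gh G1 GM] /= FG.
have e : Fo = Go by apply/funext => p; case: (Fo p); case: (Go p).
subst Go; exact: (@sfun_ext _ _ (@Sfun (simplex_scat n) N2Cat Fo Gh G1 GM) Fh F1 FM).
Qed.

(** * The given data and its invariance under surjections *)

Section Data.

Variables (X : sset) (A : X 1 -> word).
Hypothesis A_deg : forall y : X 0, A (sdeg ord0 y) = [::].
Variable T : forall n : nat, X n -> cell1.
Hypothesis T_dom : forall (n : nat) (x : X n), 0 < n -> dom1 (T x) =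
  \big[cat/[::]]_(i < n) A (edge x (widen_ord (leqnSn n) i) (lift ord0 i)).
Hypothesis T_cod : forall (n : nat) (x : X n), 0 < n ->
  cod1 (T x) = A (edge x ord0 ord_max).
Hypothesis T_id : forall x : X 1, T x = id1 (A x).
Hypothesis T_deg : forall (n : nat) (k : 'I_n.+1) (x : X n), 0 < n ->
  T (sdeg k x) = T x.
Variable eta : forall n : nat, X n -> {set 'I_n.+1} -> cell2.
Hypothesis eta_src : forall (n : nat) (x : X n) (C : {set 'I_n.+1}), 0 < n ->
  ends n \subset C -> src2 (eta x C) = comp1 (T (face x C))
    (\big[tens1/id1 [::]]_(c <- steps C) T (face x (itv c.1 c.2))).
Hypothesis eta_tgt : forall (n : nat) (x : X n) (C : {set 'I_n.+1}), 0 < n ->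
  ends n \subset C -> tgt2 (eta x C) = T x.
Hypothesis eta_ends : forall (n : nat) (x : X n), 0 < n ->
  eta x (ends n) = id2 (T x).
Hypothesis eta_full : forall (n : nat) (x : X n), 0 < n ->
  eta x [set: 'I_n.+1] = id2 (T x).
Hypothesis eta_deg : forall (n : nat) (k : 'I_n.+1) (x : X n) (C : {set 'I_n.+2}),
  0 < n -> ends n.+1 \subset C ->
  eta (sdeg k x) C = eta x [set codegen k i | i in C].

Lemma T_surj m n (s : delta m n) (x : X n) : dsurj s -> 0 < n ->
  T (sact s x) = T x.
Proof.
move=> ss; elim/dsurj_ind: m n s / ss x => [n|m n k s ss IH] x n0.
  by rewrite sact_id.
rewrite -sact_comp -[sact (codegen k) _]/(sdeg k _) T_deg ?IH //.
exact: leq_trans n0 (dsurj_leq ss).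
Qed.

Lemma eta_surj m n (s : delta m n) (x : X n) (C : {set 'I_m.+1}) : dsurj s -> 0 < n ->
  ends m \subset C -> eta (sact s x) C = eta x (s @: C).
Proof.
move=> ss; elim/dsurj_ind: m n s / ss x C => [n|m n k s ss IH] x C n0 endsC.
  by rewrite sact_id imset_id.
rewrite -sact_comp -[sact (codegen k) _]/(sdeg k _) eta_deg //; last first.
  exact: leq_trans n0 (dsurj_leq ss).
by rewrite IH ?(ends_imset (@codegen_surj _ k)) // imset_dcomp.
Qed.

(** Passing through dimension 1 gives T^{s_0 y}, the identity of A^{s_0 y} = I. The dimension enters
    as the equation [n = 0] because it is later an expression [#|D|.-1]. *)
Lemma T_const m n (s : delta m n) (x : X n) : 0 < m -> n = 0 ->
  T (sact s x) = id1 [::].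
Proof.
move=> m0 n0; subst n; have [s1 [ss1 e]] := dconst_factor m0.
have -> : s = dconst m by apply: delta_ext => i; rewrite [LHS]ord1 [RHS]ord1.
by rewrite e -sact_comp T_surj // T_id A_deg.
Qed.

Lemma eta_const m n (s : delta m n) (x : X n) (C : {set 'I_m.+1}) : 0 < m -> n = 0 ->
  ends m \subset C -> eta (sact s x) C = id2 (id1 [::]).
Proof.
move=> m0 n0 endsC; subst n; have [s1 [ss1 e]] := dconst_factor m0.
have -> : s = dconst m by apply: delta_ext => i; rewrite [LHS]ord1 [RHS]ord1.
rewrite e -sact_comp eta_surj //.
(* The image of [C] contains both ends of [1], hence is everything, and (3.a) applies. *)
have -> : s1 @: C = ends 1.
  apply/eqP; rewrite eqEsubset ends_imset // andbT.
  by apply/subsetP; case; case=> [|[|]] // h _; rewrite !inE -!val_eqE.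
by rewrite eta_ends // T_id A_deg.
Qed.

(* [T_at x D] is T^{x_D} and [eta_at x D C] is eta^{x_D} at the preimage of C
under delta_D.  One-point sets D carry identities, so that passing from D to its
image under a map of ordinals needs no case distinction. *)
Definition T_at n (x : X n) (D : {set 'I_n.+1}) : cell1 :=
  if 1 < #|D| then T (face x D) else id1 [::].

Definition eta_at n (x : X n) (D C : {set 'I_n.+1}) : cell2 :=
  if 1 < #|D| then eta (face x D) (subset_map D @^-1: C) else id2 (id1 [::]).

(* The values of phi_n(x) at a chain C, C <= D or C <= D <= E. *)
Definition prodA n (x : X n) (C : {set 'I_n.+1}) : word :=
  \big[cat/[::]]_(c <- steps C) A (edge x c.1 c.2).

Definition prodT n (x : X n) (D C : {set 'I_n.+1}) : cell1 :=
  \big[tens1/id1 [::]]_(c <- steps C) T_at x (D :&: itv c.1 c.2).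

Definition prodEta n (x : X n) (E D C : {set 'I_n.+1}) : cell2 :=
  \big[tens2/id2 (id1 [::])]_(c <- steps C)
    eta_at x (E :&: itv c.1 c.2) (D :&: itv c.1 c.2).

(** * Naturality of the data and of products over steps *)

(** The surjective part of [g] is absorbed by [T_surj], so only the image remains. If the image is a
    point, [sact g x] is a degeneracy of a vertex and both sides are the identity of I. *)
Lemma T_act m n (g : delta m n) (x : X n) : 0 < m ->
  T (sact g x) = T_at x (g @: [set: 'I_m.+1]).
Proof.
move=> m0; have [s [ss e]] := delta_factor g.
rewrite /T_at [in LHS]e -sact_comp; case: ifP => D1.
  by rewrite T_surj // -subn1 subn_gt0.
by rewrite T_const //; move: D1; case: #|_| => [|[|]].
Qed.

Lemma eta_act m n (g : delta m n) (x : X n) (C : {set 'I_m.+1}) :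
  0 < m -> ends m \subset C ->
  eta (sact g x) C = eta_at x (g @: [set: 'I_m.+1]) (g @: C).
Proof.
move=> m0 endsC; have [s [ss e]] := delta_factor g.
rewrite /eta_at [in LHS]e -sact_comp; case: ifP => D1; last first.
  by rewrite eta_const //; move: D1; case: #|_| => [|[|]].
rewrite eta_surj // -?subn1 ?subn_gt0 //; congr eta.
have gE j : g j = subset_map (g @: [set: 'I_m.+1]) (s j).
  exact: (congr1 (fun f : delta m n => f j) e).
(* Injectivity of the face map identifies the preimage of [g @: C] with [s @: C]. *)
apply/setP => i; rewrite inE; apply/imsetP/imsetP => -[j jC].
  by move=> ->; exists j; rewrite // gE.
by rewrite gE => /(subset_nth_inj (ltnW D1)); exists j.
Qed.

Lemma T_at_act m n (t : delta m n) (x : X n) D :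
  T_at (sact t x) D = T_at x (t @: D).
Proof.
rewrite {1}/T_at; case: ifP => D1; last by rewrite /T_at card_imset_le1.
rewrite /face sact_comp T_act -?subn1 ?subn_gt0 //.
by rewrite imset_dcomp subset_map_imset // ltnW.
Qed.

Lemma eta_at_act m n (t : delta m n) (x : X n) a b (D C : {set 'I_m.+1}) : spans a b D ->
  spans a b C -> C \subset D -> eta_at (sact t x) D C = eta_at x (t @: D) (t @: C).
Proof.
move=> sD sC CD; rewrite {1}/eta_at; case: ifP => D1;
  last by rewrite /eta_at card_imset_le1.
rewrite /face sact_comp eta_act -?subn1 ?subn_gt0 //; last first.
  have [aC bC _] := and3P sC; rewrite subUset !sub1set !inE /=.
  by rewrite (subset_nth_spans sD).1 (subset_nth_spans sD).2 aC.
by rewrite !imset_dcomp subset_map_imset ?subset_map_preimset // ltnW.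
Qed.

Lemma A_edge1 n (x : X n) (a : 'I_n.+1) : A (edge x a a) = [::].
Proof.
(* x_{a,a} is the degeneracy of the vertex x_a, so (1.a) applies. *)
have -> : edge x a a = sdeg ord0 (sact (@Delta 0 n (fun=> a) (fun _ _ _ => leqnn a)) x).
  rewrite /edge /sdeg sact_comp; congr sact; apply: delta_ext => i /=.
  by rewrite leqnn if_same.
exact: A_deg.
Qed.

Lemma prodA_act m n (t : delta m n) (x : X n) a b C : spans a b C ->
  prodA (sact t x) C = prodA x (t @: C).
Proof.
move=> sC; rewrite /prodA (big_steps_imset _ t sC) => [|c]; last exact: A_edge1.
by rewrite !big_seq; apply: eq_bigr => c /steps_lt/ltnW cc; rewrite edge_act.
Qed.

Lemma prodT_act m n (t : delta m n) (x : X n) a b (D C : {set 'I_m.+1}) :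
  spans a b C -> C \subset D ->
  prodT (sact t x) D C = prodT x (t @: D) (t @: C).
Proof.
move=> sC CD; rewrite /prodT (big_steps_imset _ t sC) => [|c]; last by rewrite /T_at itv1.
rewrite !big_seq; apply: eq_bigr => c cC; have [c1 c2] := steps_mem cC.
by rewrite T_at_act imset_itv ?(subsetP CD) // ltnW // (steps_lt cC).
Qed.

Lemma prodEta_act m n (t : delta m n) (x : X n) a b (E D C : {set 'I_m.+1}) :
  spans a b C -> C \subset D -> D \subset E ->
  prodEta (sact t x) E D C = prodEta x (t @: E) (t @: D) (t @: C).
Proof.
move=> sC CD DE; rewrite /prodEta (big_steps_imset _ t sC) => [|c];
  last by rewrite /eta_at itv1.
have CE := subset_trans CD DE.
rewrite !big_seq; apply: eq_bigr => c cC; have [c1 c2] := steps_mem cC.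
have cc := ltnW (steps_lt cC).
have sEc : spans c.1 c.2 (E :&: itv c.1 c.2).
  by apply: spans_itv; rewrite ?(subsetP CE).
rewrite (eta_at_act _ _ sEc) ?setSI //.
  by rewrite !imset_itv ?(subsetP CD) ?(subsetP CE).
by apply: (spans_sub sEc); rewrite ?setSI // !inE ?leqnn ?cc ?(subsetP CD).
Qed.

Lemma T_setT n (x : X n) : 0 < n -> T x = T_at x [set: 'I_n.+1].
Proof. by move=> n0; rewrite -{1}[x]sact_id T_act // imset_id. Qed.

Lemma eta_setT n (x : X n) (C : {set 'I_n.+1}) : 0 < n -> ends n \subset C ->
  eta x C = eta_at x [set: 'I_n.+1] C.
Proof. by move=> n0 endsC; rewrite -{1}[x]sact_id eta_act // !imset_id. Qed.

Lemma T_at1 n (x : X n) a : T_at x [set a] = id1 [::].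
Proof.
by have a1 : (1 < #|[set a]|) = false; [rewrite cards1 | rewrite /T_at a1].
Qed.

Lemma eta_at1 n (x : X n) a C : eta_at x [set a] C = id2 (id1 [::]).
Proof.
by have a1 : (1 < #|[set a]|) = false; [rewrite cards1 | rewrite /eta_at a1].
Qed.

(** * Boundaries of the cells attached to subsets *)

(** The pattern of most lemmas below on [T_at] and [eta_at]: if [a = b] the set is a point and both
    sides are units; otherwise it is the image of some [m], and naturality reduces the claim to a
    hypothesis on the data. *)
Lemma T_at_dom n (x : X n) a b C : spans a b C -> dom1 (T_at x C) = prodA x C.
Proof.
move=> sC; have := spans_le sC; rewrite leq_eqVlt => /orP[/eqP/val_inj ab|ab].
  by rewrite -ab in sC *; rewrite (spans1 sC) T_at1 /prodA steps_set1 big_nil.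
have [m [t [m0 _ <- _]]] := subset_map_spans sC ab.
rewrite -(prodA_act _ _ (spans_setT m)) -T_at_act -T_setT // T_dom //.
by rewrite /prodA steps_setT.
Qed.

Lemma T_at_cod n (x : X n) a b C : spans a b C -> cod1 (T_at x C) = A (edge x a b).
Proof.
move=> sC; have := spans_le sC; rewrite leq_eqVlt => /orP[/eqP/val_inj ab|ab].
  by rewrite -ab in sC *; rewrite (spans1 sC) T_at1 A_edge1.
rewrite /T_at (card_spans sC) ab T_cod; last by rewrite -subn1 subn_gt0 (card_spans sC).
by rewrite edge_face // (subset_nth_spans sC).1 (subset_nth_spans sC).2.
Qed.

Lemma T_at_edge n (x : X n) (a b : 'I_n.+1) : a < b ->
  T_at x [set a; b] = id1 (A (edge x a b)).
Proof.
move=> ab; have -> : [set a; b] = edge_map a b @: [set: 'I_2].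
  apply/setP => c; rewrite !inE; apply/orP/imsetP.
    case=> /eqP ->; [exists ord0 | exists ord_max]; rewrite ?inE //= ?(ltnW ab) //.
  by case=> i _ -> /=; rewrite (ltnW ab); case: ifP => _; [left | right].
by rewrite -T_act // T_id.
Qed.

Lemma eta_at_full n (x : X n) a b C : spans a b C -> eta_at x C C = id2 (T_at x C).
Proof.
move=> sC; have := spans_le sC; rewrite leq_eqVlt => /orP[/eqP/val_inj ab|ab].
  by rewrite -ab in sC *; rewrite (spans1 sC) eta_at1 T_at1.
have [m [t [m0 _ <- _]]] := subset_map_spans sC ab.
by rewrite -(eta_at_act _ _ (spans_setT m)) ?spans_setT // -T_at_act -eta_setT
  ?subsetT // eta_full // -T_setT.
Qed.

Lemma eta_at_ends n (x : X n) a b C : spans a b C ->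
  eta_at x C [set a; b] = id2 (T_at x C).
Proof.
move=> sC; have := spans_le sC; rewrite leq_eqVlt => /orP[/eqP/val_inj ab|ab].
  by rewrite -ab in sC *; rewrite (spans1 sC) eta_at1 T_at1.
have [m [t [m0 [ta tb] tC tsub]]] := subset_map_spans sC ab.
have -> : [set a; b] = t @: ends m by rewrite imsetU1 imset_set1 ta tb.
rewrite -tC -(eta_at_act _ _ (spans_setT m)) ?subsetT -?ends_spans // -T_at_act.
by rewrite -eta_setT // eta_ends // -T_setT.
Qed.

Lemma eta_at_src n (x : X n) a b D C : spans a b D -> spans a b C -> C \subset D ->
  src2 (eta_at x D C) = comp1 (T_at x C) (prodT x D C).
Proof.
move=> sD sC CD; have := spans_le sD; rewrite leq_eqVlt => /orP[/eqP/val_inj ab|ab].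
  rewrite -ab in sC sD *; rewrite (spans1 sC) (spans1 sD) eta_at1 T_at1.
  by rewrite /prodT steps_set1 big_nil comp1_id.
have [m [t [m0 _ tD tsub]]] := subset_map_spans sD ab.
have [sC' tC] := tsub _ sC CD; rewrite -tD -tC.
rewrite -(eta_at_act _ _ (spans_setT m)) ?subsetT // -T_at_act.
rewrite -(prodT_act _ _ sC') ?subsetT // -eta_setT ?ends_spans //.
rewrite eta_src ?ends_spans //; congr comp1.
  by rewrite /T_at (card_spans sC') m0.
rewrite /prodT !big_seq; apply: eq_bigr => c cC.
by rewrite setTI /T_at (@card_spans _ c.1 c.2) ?(steps_lt cC) //
  -[itv _ _]setTI spans_itv ?inE // ltnW // (steps_lt cC).
Qed.

Lemma eta_at_tgt n (x : X n) a b D C : spans a b D -> spans a b C -> C \subset D ->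
  tgt2 (eta_at x D C) = T_at x D.
Proof.
move=> sD sC CD; have := spans_le sD; rewrite leq_eqVlt => /orP[/eqP/val_inj ab|ab].
  by rewrite -ab in sC sD *; rewrite (spans1 sD) eta_at1 T_at1.
have [m [t [m0 _ tD tsub]]] := subset_map_spans sD ab.
have [sC' tC] := tsub _ sC CD; rewrite -tD -tC.
rewrite -(eta_at_act _ _ (spans_setT m)) ?subsetT // -T_at_act.
by rewrite -eta_setT ?ends_spans // eta_tgt ?ends_spans // -T_setT.
Qed.

(** The interchange law needs both factors of a composite indexed by the same steps; this moves the
    finer index set [D] onto the steps of [C]. *)
Lemma prodT_refine n (x : X n) a b (E D C : {set 'I_n.+1}) : spans a b C ->
  spans a b D -> C \subset D ->
  \big[tens1/id1 [::]]_(c <- steps C)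
    prodT x (E :&: itv c.1 c.2) (D :&: itv c.1 c.2) = prodT x E D.
Proof.
move=> sC sD CD; rewrite /prodT -(big_steps_refine _ _ sC sD CD).
apply: eq_bigr => c _; rewrite !big_seq; apply: eq_bigr => d dD.
by rewrite [in RHS](cap_step E dD).
Qed.

Lemma prodEta_refine n (x : X n) a b (F E D C : {set 'I_n.+1}) : spans a b C ->
  spans a b D -> C \subset D ->
  \big[tens2/id2 (id1 [::])]_(c <- steps C)
    prodEta x (F :&: itv c.1 c.2) (E :&: itv c.1 c.2) (D :&: itv c.1 c.2) =
  prodEta x F E D.
Proof.
move=> sC sD CD; rewrite /prodEta -(big_steps_refine _ _ sC sD CD).
apply: eq_bigr => c _; rewrite !big_seq; apply: eq_bigr => d dD.
by rewrite [in RHS](cap_step F dD) [in RHS](cap_step E dD).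
Qed.

Lemma prodT_dom n (x : X n) a b (D C : {set 'I_n.+1}) :
  spans a b D -> spans a b C -> C \subset D ->
  dom1 (prodT x D C) = prodA x D.
Proof.
move=> sD sC CD; rewrite /prodT dom1_tens /prodA -(big_steps_refine _ _ sC sD CD).
by rewrite !big_seq; apply: eq_bigr => c cC; rewrite (T_at_dom _ (spans_step CD cC)).
Qed.

Lemma prodT_cod n (x : X n) (D C : {set 'I_n.+1}) : C \subset D ->
  cod1 (prodT x D C) = prodA x C.
Proof.
move=> CD; rewrite /prodT cod1_tens.
rewrite /prodA !big_seq; apply: eq_bigr => c cC.
by rewrite (T_at_cod _ (spans_step CD cC)).
Qed.

Lemma prodT_id n (x : X n) (C : {set 'I_n.+1}) : prodT x C C = id1 (prodA x C).
Proof.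
rewrite /prodT /prodA -id1_tens !big_seq; apply: eq_bigr => c cC.
by rewrite (steps_itv cC) T_at_edge // (steps_lt cC).
Qed.

Lemma prodEta_src n (x : X n) a b (E D C : {set 'I_n.+1}) :
  spans a b D -> spans a b C -> C \subset D -> D \subset E ->
  src2 (prodEta x E D C) = comp1 (prodT x D C) (prodT x E D).
Proof.
move=> sD sC CD DE; have CE := subset_trans CD DE.
rewrite /prodEta src2_tens -(prodT_refine _ _ sC sD CD) /prodT -comp1_tens.
  rewrite !big_seq; apply: eq_bigr => c cC.
  by rewrite (eta_at_src _ (spans_step CE cC) (spans_step CD cC)) ?setSI.
move=> c cC; rewrite (T_at_dom _ (spans_step CD cC)).
by rewrite prodT_cod ?setSI.
Qed.

Lemma prodEta_tgt n (x : X n) (E D C : {set 'I_n.+1}) :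
  C \subset D -> D \subset E -> tgt2 (prodEta x E D C) = prodT x E C.
Proof.
move=> CD DE; have CE := subset_trans CD DE.
rewrite /prodEta tgt2_tens /prodT !big_seq; apply: eq_bigr => c cC.
by rewrite (eta_at_tgt _ (spans_step CE cC) (spans_step CD cC)) ?setSI.
Qed.

Lemma prodEta_idl n (x : X n) (D C : {set 'I_n.+1}) : C \subset D ->
  prodEta x D D C = id2 (prodT x D C).
Proof.
move=> CD; rewrite /prodEta /prodT -id2_tens !big_seq; apply: eq_bigr => c cC.
by rewrite (eta_at_full _ (spans_step CD cC)).
Qed.

Lemma prodEta_idr n (x : X n) (D C : {set 'I_n.+1}) : C \subset D ->
  prodEta x D C C = id2 (prodT x D C).
Proof.
move=> CD; rewrite /prodEta /prodT -id2_tens !big_seq; apply: eq_bigr => c cC.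
by rewrite (steps_itv cC) (eta_at_ends _ (spans_step CD cC)).
Qed.

Lemma eta_at_dom2 n (x : X n) a b (D C : {set 'I_n.+1}) :
  spans a b D -> spans a b C -> C \subset D -> dom2 (eta_at x D C) = prodA x D.
Proof.
move=> sD sC CD.
by rewrite -[LHS]/(dom1 (tgt2 _)) (eta_at_tgt _ sD sC CD) (T_at_dom _ sD).
Qed.

Lemma prodEta_cod2 n (x : X n) (E D C : {set 'I_n.+1}) :
  C \subset D -> D \subset E -> cod2 (prodEta x E D C) = prodA x C.
Proof.
move=> CD DE.
by rewrite cod2E prodEta_tgt // prodT_cod // (subset_trans CD).
Qed.

Lemma prodT_set2 n (x : X n) a b (D : {set 'I_n.+1}) :
  spans a b D -> a < b -> prodT x D [set a; b] = T_at x D.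
Proof.
by move=> sD ab; rewrite /prodT steps_set2 // big_seq1 (spans_cap sD).
Qed.

Lemma prodEta_set2 n (x : X n) a b (E D : {set 'I_n.+1}) :
  spans a b E -> spans a b D -> a < b -> prodEta x E D [set a; b] = eta_at x E D.
Proof.
by move=> sE sD ab; rewrite /prodEta steps_set2 // big_seq1 (spans_cap sE) (spans_cap sD).
Qed.

(** * The coherence identity *)

(** For sets spanning a common interval, this is the displayed identity for the face x_E, written
    with subsets of [n] so that it can be carried along maps of ordinals. *)
Definition coherent n (x : X n) (E D C : {set 'I_n.+1}) :=
  vcomp (eta_at x E D) (hcomp (eta_at x D C) (id2 (prodT x E D))) =
  vcomp (eta_at x E C) (hcomp (id2 (T_at x C)) (prodEta x E D C)).

Lemma coh_act m n (t : delta m n) (x : X n) a b E D C :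
  spans a b E -> spans a b D -> spans a b C -> C \subset D -> D \subset E ->
  coherent (sact t x) E D C <-> coherent x (t @: E) (t @: D) (t @: C).
Proof.
move=> sE sD sC CD DE; have CE := subset_trans CD DE; rewrite /coherent.
by rewrite (eta_at_act _ _ sE sD DE) (eta_at_act _ _ sD sC CD) (eta_at_act _ _ sE sC CE)
  (prodT_act _ _ sD DE) T_at_act (prodEta_act _ _ sC CD DE).
Qed.

(** The 3-simplex equation of N_2(Cat) for products: once every factor is a product over the steps
    of the smallest set [C], both sides are products of the corresponding sides for single steps. *)
Lemma coh_EE n (x : X n) a b (F E D C : {set 'I_n.+1}) :
  spans a b E -> spans a b D -> spans a b C ->
  C \subset D -> D \subset E -> E \subset F ->
  (forall c, c \in steps C -> coherent x (F :&: itv c.1 c.2) (E :&: itv c.1 c.2)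
     (D :&: itv c.1 c.2)) ->
  vcomp (prodEta x F E C) (hcomp (prodEta x E D C) (id2 (prodT x F E))) =
  vcomp (prodEta x F D C) (hcomp (id2 (prodT x D C)) (prodEta x F E D)).
Proof.
move=> sE sD sC CD DE EF cohx.
have CE := subset_trans CD DE; have CF := subset_trans CE EF.
have sFc c cC := @spans_step _ C F c CF cC.
have sEc c cC := @spans_step _ C E c CE cC.
have sDc c cC := @spans_step _ C D c CD cC.
have hl : {in steps C, forall c,
    cod2 (id2 (prodT x (F :&: itv c.1 c.2) (E :&: itv c.1 c.2))) =
    dom2 (eta_at x (E :&: itv c.1 c.2) (D :&: itv c.1 c.2))}.
  move=> c cC; rewrite (eta_at_dom2 _ (sEc c cC) (sDc c cC)) ?setSI //.
  by rewrite [LHS]prodT_cod ?setSI.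
have hr : {in steps C, forall c, cod2 (prodEta x (F :&: itv c.1 c.2)
      (E :&: itv c.1 c.2) (D :&: itv c.1 c.2)) =
    dom2 (id2 (T_at x (D :&: itv c.1 c.2)))}.
  move=> c cC; rewrite prodEta_cod2 ?setSI //.
  by rewrite [RHS](T_at_dom _ (sDc c cC)).
(* The factors indexed by the finer sets [E] and [D] are regrouped along [C]; the others are
   products over its steps already. *)
rewrite -(prodT_refine _ _ sC sE CE) -(prodEta_refine _ _ _ sC sD CD) -id2_tens.
rewrite -[prodT x D C]/(\big[tens1/id1 [::]]_(c <- steps C) _) -id2_tens.
rewrite -(hcomp_tens hl) -(hcomp_tens hr).
rewrite -!vcomp_tens.
- by rewrite !big_seq; apply: eq_bigr => c cC; exact: cohx.
- move=> c cC; rewrite tgt2_hcomp ?hr // tgt2_id.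
  rewrite prodEta_tgt ?setSI //.
  by rewrite (eta_at_src _ (sFc c cC) (sDc c cC)) ?setSI // (subset_trans DE).
- move=> c cC; rewrite tgt2_hcomp ?hl // tgt2_id.
  rewrite (eta_at_tgt _ (sEc c cC) (sDc c cC)) ?setSI //.
  by rewrite (eta_at_src _ (sFc c cC) (sEc c cC)) ?setSI.
Qed.

(** Here and in the next two lemmas one inclusion is an equality. (3.a) turns a factor on each side
    into an identity, and the unit laws make what is left agree. *)
Lemma coh_full n (x : X n) a b (E C : {set 'I_n.+1}) :
  spans a b E -> spans a b C -> C \subset E -> coherent x E E C.
Proof.
move=> sE sC CE; rewrite /coherent (eta_at_full _ sE) prodEta_idl // prodT_id.
rewrite hcomp_id2; last by rewrite prodT_cod // (T_at_dom _ sC).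
rewrite hcomp_idr ?(eta_at_dom2 _ sE sC CE) // vcomp_idl ?(eta_at_tgt _ sE sC CE) //.
by rewrite vcomp_idr // (eta_at_src _ sE sC CE).
Qed.

Lemma coh_diag n (x : X n) a b (E C : {set 'I_n.+1}) :
  spans a b E -> spans a b C -> C \subset E -> coherent x E C C.
Proof.
by move=> sE sC CE; rewrite /coherent (eta_at_full _ sC) prodEta_idr //.
Qed.

Lemma coh_ends n (x : X n) a b (E D : {set 'I_n.+1}) :
  spans a b E -> spans a b D -> D \subset E -> coherent x E D [set a; b].
Proof.
move=> sE sD DE; have := spans_le sE; rewrite leq_eqVlt => /orP[/eqP/val_inj ab|ab].
  rewrite -ab in sE sD *; rewrite setUid -(spans1 sD).
  exact: coh_diag sE sD DE.
rewrite /coherent (eta_at_ends _ sD) (eta_at_ends _ sE) (prodEta_set2 _ sE sD ab).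
rewrite T_at_edge //.
rewrite hcomp_id2; last by rewrite prodT_cod // (T_at_dom _ sD).
rewrite vcomp_idr ?(eta_at_src _ sE sD DE) // hcomp_idl.
  by rewrite vcomp_idl // (eta_at_tgt _ sE sD DE).
by rewrite cod2E (eta_at_tgt _ sE sD DE) (T_at_cod _ sE).
Qed.

(** Since [0 < n], every set that occurs has at least two elements, so [T_at] and [eta_at] take
    their values from the data and not from the convention on points. *)
Lemma cohE n (x : X n) (C D : {set 'I_n.+1}) : 0 < n ->
  ends n \subset C -> C \subset D ->
  coherent x [set: 'I_n.+1] D C <->
  vcomp (eta x D)
    (hcomp (eta (face x D) (subset_map D @^-1: C))
      (id2 (\big[tens1/id1 [::]]_(d <- steps D) T (face x (itv d.1 d.2))))) =
  vcomp (eta x C)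
    (hcomp (id2 (T (face x C)))
      (\big[tens2/id2 (id1 [::])]_(c <- steps C)
        eta (face x (itv c.1 c.2)) (subset_map (itv c.1 c.2) @^-1: (D :&: itv c.1 c.2)))).
Proof.
move=> n0 eC CD; have eD := subset_trans eC CD.
have sC := eC; rewrite ends_spans in sC; have sD := eD; rewrite ends_spans in sD.
have itv_gt1 (B : {set 'I_n.+1}) c : c \in steps B -> 1 < #|itv c.1 c.2|.
  move=> /steps_lt cc; rewrite (@card_spans _ c.1 c.2) //.
  by rewrite -[itv _ _]setTI spans_itv ?inE // ltnW.
rewrite /coherent -!eta_setT // /prodT /prodEta {1}/eta_at [T_at x C]/T_at.
rewrite !(card_spans sD, card_spans sC) n0.
suff [-> ->] :
  \big[tens1/id1 [::]]_(d <- steps D) T_at x ([set: 'I_n.+1] :&: itv d.1 d.2) =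
    \big[tens1/id1 [::]]_(d <- steps D) T (face x (itv d.1 d.2)) /\
  \big[tens2/id2 (id1 [::])]_(c <- steps C)
      eta_at x ([set: 'I_n.+1] :&: itv c.1 c.2) (D :&: itv c.1 c.2) =
    \big[tens2/id2 (id1 [::])]_(c <- steps C) eta (face x (itv c.1 c.2))
      (subset_map (itv c.1 c.2) @^-1: (D :&: itv c.1 c.2)) by [].
by split; rewrite !big_seq; apply: eq_bigr => c /itv_gt1 c1;
  rewrite setTI /T_at /eta_at c1.
Qed.

(** * The simplicial map built from coherent data *)

Section Coherent.

Hypothesis eta_coh : forall (n : nat) (x : X n) (C D : {set 'I_n.+1}),
  4 <= n -> ~ degenerate x -> ends n \proper C -> C \proper D ->
  D \proper [set: 'I_n.+1] -> coherent x [set: 'I_n.+1] D C.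

Lemma coh_setT n (x : X n) (C D : {set 'I_n.+1}) :
  ends n \subset C -> C \subset D -> coherent x [set: 'I_n.+1] D C.
Proof.
elim/degenerate_case: n / x C D => [n x ndx|n k y IH] C D eC CD; last first.
  have eD := subset_trans eC CD.
  have sC := eC; rewrite ends_spans in sC; have sD := eD; rewrite ends_spans in sD.
  (* The codegeneracy may make the images of [C] and [D] coincide or fill [n]; this is why the
     induction runs over weak inclusions. *)
  apply/(coh_act _ _ (spans_setT n.+1) sD sC) => //.
  rewrite dsurj_imset; last exact: codegen_surj.
  by apply: IH; [apply: ends_imset => //; exact: codegen_surj | exact: imsetS].
have eD := subset_trans eC CD.
have sC := eC; rewrite ends_spans in sC; have sD := eD; rewrite ends_spans in sD.
have sT := spans_setT n; have DT := subsetT D; have CT := subsetT C.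
case: (eqVneq C (ends n)) => [->|neC]; first exact: coh_ends sT sD DT.
case: (eqVneq C D) => [->|nCD]; first exact: coh_diag sT sD DT.
case: (eqVneq D [set: 'I_n.+1]) => [->|nDT]; first exact: coh_full sT sC CT.
have pC : ends n \proper C by rewrite properEneq eq_sym neC.
have pD : C \proper D by rewrite properEneq nCD.
have pT : D \proper [set: 'I_n.+1] by rewrite properEneq nDT.
apply: eta_coh => //.
(* Three strict inclusions. With two distinct ends the bound says [4 <= n]; for [n = 0] it says
   [4 <= 1], which is absurd. *)
have : #|ends n|.+3 <= n.+1.
  have := proper_card pT; rewrite cardsT card_ord; apply: leq_trans.
  rewrite ltnS; apply: leq_trans (proper_card pD).
  by rewrite ltnS; exact: proper_card.
by rewrite cards2 -val_eqE /=; case: (n) => [|m].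
Qed.

Lemma coh_all n (x : X n) a b (E D C : {set 'I_n.+1}) : spans a b E ->
  spans a b D -> spans a b C -> C \subset D -> D \subset E -> coherent x E D C.
Proof.
move=> sE sD sC CD DE; have CE := subset_trans CD DE.
have := spans_le sE; rewrite leq_eqVlt => /orP[/eqP/val_inj ab|ab].
  rewrite -ab in sE sD sC; rewrite (spans1 sD) -(spans1 sC).
  exact: coh_diag sE sC CE.
have [m [t [m0 _ tE tsub]]] := subset_map_spans sE ab.
have [sD' tD] := tsub _ sD DE; have [sC' tC] := tsub _ sC CE.
have CD' : t @^-1: C \subset t @^-1: D by exact: preimsetS.
rewrite -tE -tD -tC; apply/(coh_act _ _ (spans_setT m) sD' sC') => //.
by apply: coh_setT; rewrite ?ends_spans.
Qed.

Definition coh_simplex n (x : X n) (p q : 'I_n.+1) m (C : chain p q m) : n2_simplex m.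
Proof.
exists (fun i => prodA x (C i)) (fun i j _ => prodT x (C i) (C j))
  (fun i j k _ _ => prodEta x (C i) (C j) (C k)).
- by move=> i j ij; rewrite (prodT_dom _ (chain_spans C i) (chain_spans C j)) ?csetS.
- by move=> i j ij; rewrite prodT_cod ?csetS.
- by move=> i _; rewrite prodT_id.
- move=> i j k ij jk.
  by rewrite (prodEta_src _ (chain_spans C j) (chain_spans C k)) ?csetS.
- by move=> i j k ij jk _; rewrite prodEta_tgt ?csetS.
- by move=> i j _ ij; rewrite prodEta_idl ?csetS.
- by move=> i j ij _; rewrite prodEta_idr ?csetS.
(* The one field that rests on the displayed identity, used on each step of the smallest set
   [C l]. *)
move=> i j k l ij jk kl _ _.
have ji := csetS C ij; have kj := csetS C jk; have lk := csetS C kl.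
have sC := chain_spans C.
rewrite (coh_EE (sC j) (sC k) (sC l)) // => c cC.
by apply: coh_all (spans_step _ cC) (spans_step _ cC)
  (spans_step _ cC) _ _; rewrite ?setSI //
  ?(subset_trans lk) ?(subset_trans kj).
Defined.

Lemma prodA_setU n (x : X n) p q r C D : spans p q C -> spans q r D ->
  prodA x (C :|: D) = prodA x C ++ prodA x D.
Proof. by move=> sC sD; rewrite /prodA (steps_setU sC sD) big_cat. Qed.

Lemma prodT_setU n (x : X n) p q r C D C' D' : spans p q C -> spans q r D ->
  spans p q C' -> spans q r D' ->
  prodT x (C :|: D) (C' :|: D') = tens1 (prodT x C C') (prodT x D D').
Proof.
move=> sC sD sC' sD'; rewrite /prodT (steps_setU sC' sD') big_cat; congr tens1.
  rewrite !big_seq; apply: eq_bigr => c cC'.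
  by rewrite (setU_itvl _ sC sD) // (steps_spans sC' cC').2.
rewrite !big_seq; apply: eq_bigr => c cD'.
by rewrite (setU_itvr _ sC sD) // (steps_spans sD' cD').1.
Qed.

Lemma prodEta_setU n (x : X n) p q r C D C' D' C'' D'' :
  spans p q C -> spans q r D -> spans p q C' -> spans q r D' ->
  spans p q C'' -> spans q r D'' ->
  prodEta x (C :|: D) (C' :|: D') (C'' :|: D'') =
  tens2 (prodEta x C C' C'') (prodEta x D D' D'').
Proof.
move=> sC sD sC' sD' sC'' sD''; rewrite /prodEta (steps_setU sC'' sD'') big_cat.
congr tens2; rewrite !big_seq; apply: eq_bigr => c cC.
  have cq := (steps_spans sC'' cC).2.
  by rewrite (setU_itvl _ sC sD) // (setU_itvl _ sC' sD').
have qc := (steps_spans sD'' cC).1.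
by rewrite (setU_itvr _ sC sD) // (setU_itvr _ sC' sD').
Qed.

Definition coh_sfun n (x : X n) : sfun (simplex_scat n) N2Cat.
Proof.
unshelve refine (@Sfun (simplex_scat n) N2Cat (fun=> tt) (fun p q =>
  @Smap (chain_sset p q) n2_sset (@coh_simplex n x p q) _) _ _).
- by move=> k m t C; exact: n2_ext.
- move=> p; apply: n2_ext => [i|i j ij|i j k ij jk] /=.
  + by rewrite /prodA steps_set1 big_nil.
  + by rewrite /prodT steps_set1 big_nil.
  + by rewrite /prodEta steps_set1 big_nil.
- move=> p q r m C D; apply: n2_ext => [i|i j ij|i j k ij jk] /=.
  + by rewrite (prodA_setU _ (chain_spans C i) (chain_spans D i)).
  + by rewrite (prodT_setU _ (chain_spans C i) (chain_spans D i)
      (chain_spans C j) (chain_spans D j)).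
  + by rewrite (prodEta_setU _ (chain_spans C i) (chain_spans D i)
      (chain_spans C j) (chain_spans D j) (chain_spans C k) (chain_spans D k)).
Defined.

Definition coh_smap : smap X (hc_nerve N2Cat).
Proof.
exists (fun n x => coh_sfun x) => m n t x; apply: sfun_N2Cat_ext => p q k C.
have sC := chain_spans C.
apply: n2_ext => [i|i j ij|i j l ij jl] /=.
- by rewrite (prodA_act _ _ (sC i)).
- by rewrite (prodT_act _ _ (sC j)) ?csetS.
- by rewrite (prodEta_act _ _ (sC l)) ?csetS.
Defined.

End Coherent.

(** * Values forced on a simplicial map, and uniqueness *)

Section Values.

Variable phi : smap X (hc_nerve N2Cat).
Hypothesis phi_mid : forall (n : nat) (x : X n) (C : {set 'I_n.+1})
  (endsC : ends n \subset C), 0 < n ->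
  n2_nattrans (sfhom (phi n x) 2 (chain_mid endsC)) = eta x C.

Let i1 : 'I_3 := @Ordinal 3 1 isT.
Let i2 : 'I_3 := @Ordinal 3 2 isT.

(** Typed as [n2_simplex m] whatever objects [phi n x] assigns to [p] and [q], so that values of
    different maps can be compared. *)
Definition chain_val n (x : X n) (p q : 'I_n.+1) m (C : chain p q m) : n2_simplex m :=
  @sfhom (simplex_scat n) N2Cat (phi n x) p q m C.

Lemma chain_val_act m n (t : delta m n) (x : X n) (p q : 'I_m.+1) k (C : chain p q k) :
  chain_val x (chain_image t C) = chain_val (sact t x) C.
Proof. by rewrite /chain_val smapN. Qed.

(** With [{p, q}] as its smallest set, the chain is the image of some [chain_mid] under the face map
    of its largest set, and naturality of [phi] gives the value. *)
Lemma chain_val_edge n (x : X n) (p q : 'I_n.+1) (C : chain p q 2) :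
  p < q -> C i2 = [set p; q] ->
  n2_nattrans (chain_val x C) = eta_at x (C ord0) (C i1).
Proof.
move=> pq C2; have sC := chain_spans C.
have [m [t [m0 [tp tq] tC tsub]]] := subset_map_spans (sC ord0) pq.
have [sC1 tC1] := tsub _ (sC i1) (@csetS _ _ _ _ C ord0 i1 isT).
have eC1 : ends m \subset t @^-1: C i1 by rewrite ends_spans.
rewrite -tC -[in RHS]tC1 -eta_act // -(phi_mid _ eC1) //.
subst p q; rewrite -[sfhom _ _ _]/(chain_val _ _) -chain_val_act.
congr n2_nattrans; congr chain_val.
apply: chain_ext; case; case=> [|[|[|]]] //= h.
- by rewrite tC; congr (cset C _); apply/val_inj.
- by rewrite tC1; congr (cset C _); apply/val_inj.
- by rewrite imsetU1 imset_set1 -C2; congr (cset C _); apply/val_inj.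
Qed.

(** Induction over the steps of the smallest set: the chain is cut at the end of the first step, and
    [phi n x], being an enriched functor, sends the composite to a product. *)
Lemma chain_val2 n (x : X n) (p q : 'I_n.+1) (C : chain p q 2) :
  n2_nattrans (chain_val x C) = prodEta x (C ord0) (C i1) (C i2).
Proof.
have [S SE] : exists S, S = C i2 by exists (C i2).
rewrite -SE; have sS : spans p q S by rewrite SE; exact: chain_spans.
(* [chain_cap] refers to [ord_max] and the value to [i2]: the same index with different bound
   proofs. *)
have C2 : C ord_max = C i2 by congr (cset C _); apply/val_inj.
elim/spans_ind: p q S / sS C SE C2 => [p|p q c S sS cS pc pcS IH] C SE C2.
  (* A chain from [p] to [p] is a degeneracy of the identity, which is sent to the unit. *)
  have -> : C = chain_act (dconst 2) (chain_id p).
    by apply: chain_ext => i; rewrite [LHS](spans1 (chain_spans C i)).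
  rewrite /prodEta steps_set1 big_nil /chain_val.
  have := smapN (sfhom (phi n x)) (dconst 2) (chain_id p).
  by move=> /= ->; rewrite -[chain_id p]/(@sidm (simplex_scat n) p) sfhom1.
have [pS qS _] := and3P sS; have sC := chain_spans C.
have cq : c <= q by case/spansP: sS => _ _ /(_ c cS)/andP[].
have cC : c \in C ord_max by rewrite C2 -SE.
have pC := cset_min C ord_max; have qC := cset_max C ord_max.
pose D := chain_cap pC cC (ltnW pc); pose E := chain_cap cC qC cq.
have CDE : C = chain_comp D E.
  apply: chain_ext => i; apply/setP => d.
  rewrite !inE -andb_orr.
  case: (boolP (d \in C i)) => //= dC.
  have /andP[-> ->] : p <= d <= q by case/spansP: (sC i) => _ _; apply.
  by rewrite andbT; case: leqP => // /ltnW ->.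
have -> : n2_nattrans (chain_val x C) =
    tens2 (n2_nattrans (chain_val x D)) (n2_nattrans (chain_val x E)).
  rewrite [in LHS]CDE /chain_val.
  by rewrite -[chain_comp D E]/(@scmp (simplex_scat n) p c q 2 D E) sfhomM.
rewrite chain_val_edge //; last by rewrite /= -SE.
rewrite (IH E) /= ?C2 -?SE // /prodEta -[in RHS](spans_cap sS).
rewrite (steps_cat (ltnW pc) cq cS) pcS steps_set2 // big_cat big_seq1 /=.
congr tens2; rewrite !big_seq; apply: eq_bigr => d dS.
by rewrite -!(@cap_step _ S _ (c, q) d dS).
Qed.

(** A simplex of N_2(Cat) is read off its 2-simplices, here along [pick3]. *)
Lemma chain_valE n (x : X n) (p q : 'I_n.+1) m (C : chain p q m)
    (i j k : 'I_m.+1) (ij : i <= j) (jk : j <= k) :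
  n2nat (chain_val x C) ij jk = prodEta x (C i) (C j) (C k).
Proof.
have := chain_val2 x (chain_act (pick3 ij jk) C); rewrite /= => <-.
rewrite /chain_val -[chain_act _ _]/(@sact (chain_sset p q) _ _ (pick3 ij jk) C) smapN.
exact: n2nat_irr.
Qed.

Lemma coh_of_smap n (x : X n) (C D : {set 'I_n.+1}) : 0 < n ->
  ends n \subset C -> C \subset D -> coherent x [set: 'I_n.+1] D C.
Proof.
move=> n0 eC CD; have eD := subset_trans eC CD.
have sC := eC; rewrite ends_spans in sC; have sD := eD; rewrite ends_spans in sD.
have := @n2coh 3 (chain_val x (chain_flag eC CD))
  (@Ordinal 4 0 isT) (@Ordinal 4 1 isT) (@Ordinal 4 2 isT) (@Ordinal 4 3 isT)
  isT isT isT isT isT.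
(* Functors are rewritten as targets of 2-cells with a repeated vertex, so that [chain_valE]
   computes every cell of the equation. *)
have n2funE m (s : n2_simplex m) (i j : 'I_m.+1) (ij : i <= j) (jj : j <= j) :
  n2fun s ij = tgt2 (n2nat s ij jj) by rewrite (n2tgt _ _ _ ij).
rewrite !(n2funE _ _ _ _ _ (leqnn _)) !chain_valE /=.
have sT := spans_setT n.
have lt0 : @ord0 n < @ord_max n by [].
rewrite !prodEta_tgt ?subsetT //.
by rewrite (prodEta_set2 _ sT sD lt0) (prodEta_set2 _ sD sC lt0)
  (prodEta_set2 _ sT sC lt0) (prodT_set2 _ sC lt0).
Qed.

End Values.

Lemma smap_N2Cat_unique (phi psi : smap X (hc_nerve N2Cat)) :
  (forall (n : nat) (x : X n) (C : {set 'I_n.+1}) (endsC : ends n \subset C),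
    0 < n -> n2_nattrans (sfhom (phi n x) 2 (chain_mid endsC)) = eta x C) ->
  (forall (n : nat) (x : X n) (C : {set 'I_n.+1}) (endsC : ends n \subset C),
    0 < n -> n2_nattrans (sfhom (psi n x) 2 (chain_mid endsC)) = eta x C) ->
  phi = psi.
Proof.
move=> phiE psiE; apply: smap_ext => n x; apply: sfun_N2Cat_ext => p q m C.
have eqn (i j k : 'I_m.+1) (ij : i <= j) (jk : j <= k) :
    n2nat (chain_val phi x C) ij jk = n2nat (chain_val psi x C) ij jk.
  by rewrite !chain_valE.
(* The functors are recovered as targets of the 2-cells, and then the categories as domains of the
   functors. *)
have eqf (i j : 'I_m.+1) (ij : i <= j) :
    n2fun (chain_val phi x C) ij = n2fun (chain_val psi x C) ij.
  by rewrite -(n2tgt _ ij (leqnn j)) eqn (n2tgt _ _ _ ij).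
apply: (@n2_ext _ (chain_val phi x C) (chain_val psi x C)) => // i.
by rewrite -(n2dom _ (leqnn i)) eqf n2dom.
Qed.

Lemma coh_smapP (eta_coh : forall (n : nat) (x : X n) (C D : {set 'I_n.+1}),
  4 <= n -> ~ degenerate x -> ends n \proper C -> C \proper D ->
  D \proper [set: 'I_n.+1] -> coherent x [set: 'I_n.+1] D C)
  (phi := coh_smap eta_coh) :
  [/\ forall x : X 1, n2_cat (sfhom (phi 1 x) 0 (chain_ends 1)) = A x,
      forall (n : nat) (x : X n), 0 < n ->
        n2_functor (sfhom (phi n x) 1 (chain_full n)) = T x
    & forall (n : nat) (x : X n) (C : {set 'I_n.+1})
        (endsC : ends n \subset C), 0 < n ->
        n2_nattrans (sfhom (phi n x) 2 (chain_mid endsC)) = eta x C].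
Proof.
split=> [x|n x n0|n x C endsC n0].
(* The edge from 0 to 1 in [1] is the identity map, so its action returns [x]. *)
- rewrite /n2_cat /= /prodA steps_set2 // big_seq1 /= -[x in RHS]sact_id; congr A.
  by congr sact; apply: delta_ext; case; case=> [|[|]] // h; apply/val_inj.
- by rewrite /n2_functor /= (prodT_set2 _ (spans_setT n) n0) -T_setT.
- rewrite /n2_nattrans /= (prodEta_set2 _ (spans_setT n) _ n0) -?ends_spans //.
  by rewrite -eta_setT.
Qed.

End Data.

(** * Equivalence of the unique extension with the coherence identity *)

Theorem proposition3p2
  (X : sset)
  (A : X 1 -> word)
  (A_deg : forall y : X 0, A (sdeg ord0 y) = [::])
  (T : forall n : nat, X n -> cell1)
  (T_dom : forall (n : nat) (x : X n), 0 < n ->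
     dom1 (T n x) =
     \big[cat/[::]]_(i < n) A (edge x (widen_ord (leqnSn n) i) (lift ord0 i)))
  (T_cod : forall (n : nat) (x : X n), 0 < n ->
     cod1 (T n x) = A (edge x ord0 ord_max))
  (T_id : forall x : X 1, T 1 x = id1 (A x))
  (T_deg : forall (n : nat) (k : 'I_n.+1) (x : X n), 0 < n ->
     T n.+1 (sdeg k x) = T n x)
  (eta : forall n : nat, X n -> {set 'I_n.+1} -> cell2)
  (eta_src : forall (n : nat) (x : X n) (C : {set 'I_n.+1}), 0 < n ->
     ends n \subset C ->
     src2 (eta n x C) =
     comp1 (T _ (face x C))
           (\big[tens1/id1 [::]]_(c <- steps C) T _ (face x (itv c.1 c.2))))
  (eta_tgt : forall (n : nat) (x : X n) (C : {set 'I_n.+1}), 0 < n ->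
     ends n \subset C -> tgt2 (eta n x C) = T n x)
  (eta_ends : forall (n : nat) (x : X n), 0 < n ->
     eta n x (ends n) = id2 (T n x))
  (eta_full : forall (n : nat) (x : X n), 0 < n ->
     eta n x [set: 'I_n.+1] = id2 (T n x))
  (eta_deg : forall (n : nat) (k : 'I_n.+1) (x : X n) (C : {set 'I_n.+2}),
     0 < n -> ends n.+1 \subset C ->
     eta n.+1 (sdeg k x) C = eta n x [set codegen k i | i in C]) :
  (exists! phi : smap X (hc_nerve N2Cat),
     [/\ forall x : X 1, n2_cat (sfhom (phi 1 x) 0 (chain_ends 1)) = A x,
         forall (n : nat) (x : X n), 0 < n ->
           n2_functor (sfhom (phi n x) 1 (chain_full n)) = T n x
       & forall (n : nat) (x : X n) (C : {set 'I_n.+1})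
           (endsC : ends n \subset C), 0 < n ->
           n2_nattrans (sfhom (phi n x) 2 (chain_mid endsC)) = eta n x C])
  <->
  (forall (n : nat) (x : X n) (C D : {set 'I_n.+1}), 4 <= n ->
     ~ degenerate x ->
     ends n \proper C -> C \proper D -> D \proper [set: 'I_n.+1] ->
     vcomp (eta n x D)
       (hcomp (eta _ (face x D) (subset_map D @^-1: C))
          (id2 (\big[tens1/id1 [::]]_(d <- steps D)
                  T _ (face x (itv d.1 d.2))))) =
     vcomp (eta n x C)
       (hcomp (id2 (T _ (face x C)))
          (\big[tens2/id2 (id1 [::])]_(c <- steps C)
             eta _ (face x (itv c.1 c.2))
               (subset_map (itv c.1 c.2) @^-1: (D :&: itv c.1 c.2))))).
Proof.
split=> [[phi [[_ _ phiE] _]] n x C D n4 _ eC CD _|eta_coh].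
  have n0 : 0 < n by apply: leq_trans n4.
  have := coh_of_smap A_deg T_id T_deg eta_tgt eta_ends eta_deg phiE x n0
    (proper_sub eC) (proper_sub CD).
  by move/(cohE A_deg T_id eta_ends eta_deg); apply; rewrite ?proper_sub.
have cohx n (x : X n) (C D : {set 'I_n.+1}) : 4 <= n -> ~ degenerate x ->
    ends n \proper C -> C \proper D -> D \proper [set: 'I_n.+1] ->
    coherent T eta x [set: 'I_n.+1] D C.
  move=> n4 ndx eC CD DT; have n0 : 0 < n by apply: leq_trans n4.
  apply/(cohE A_deg T_id eta_ends eta_deg); rewrite ?proper_sub //.
  exact: eta_coh.
have phiP := coh_smapP A_deg T_dom T_cod T_id T_deg eta_src eta_tgt eta_ends
  eta_full eta_deg cohx.
exists (coh_smap A_deg T_dom T_cod T_id T_deg eta_src eta_tgt eta_ends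
  eta_full eta_deg cohx); split=> // psi [_ _ psiE].
have [_ _ phiE] := phiP.
exact: (smap_N2Cat_unique A_deg T_id eta_ends eta_deg phiE psiE).
Qed.
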